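(* Let $\mathcal{E}$ be an exponential family of dimension $n$ defined over a finite set $\Omega=\{x_1,\dots,x_m\}$, and let $\Phi:\mathbb{T}^n\times N\to N$ be a Kähler toric manifold with Kähler metric $g$ which is a regular torification of $\mathcal{E}$. Let $f(p)=\mathbb{E}_{K(\phi(p))}(X)$ be a Kähler function on $N$, where $K$ is the natural extension of some compatible projection, $\phi\in\mathrm{Aut}(N,g)^0$ and $X\in\mathcal{A}_{\mathcal{E}}$. Then for all $p\in N$: $$\mathbb{V}_{K(\phi(p))}(X)=\|\,\mathrm{grad}^g(f)(p)\,\|^2,$$ where $\mathbb{V}_q(X)=\mathbb{E}_q\big((X-\mathbb{E}_q(X))^2\big)$ is the variance, $\mathrm{grad}^g(f)$ is the Riemannian gradient of $f$ with respect to $g$, and $\|u\|^2=g(u,u)$.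
   Context: Kähler toric manifolds. $\mathbb{T}^n=\mathbb{R}^n/\mathbb{Z}^n$; its Lie algebra is identified with $\mathbb{R}^n$ via the derivative at $0$ of the quotient map, and $\mathbb{R}^n$ with its dual via the Euclidean product $\langle\,,\,\rangle$. For an action $\Phi:\mathbb{T}^n\times N\to N$ write $\Phi_a(p)=\Phi(a,p)$ and $\xi_N(p)=\frac{d}{dt}\big|_0\Phi([t\xi],p)$ for $\xi\in\mathbb{R}^n$. A Kähler toric manifold is a connected compact Kähler manifold $N$ of complex dimension $n$ (metric $g$, complex structure $I$, Kähler form $\omega=g(I\cdot,\cdot)$) with an effective action $\Phi$ of $\mathbb{T}^n$ by holomorphic isometries and a momentum map $\mathbf{J}:N\to\mathbb{R}^n$, i.e. a smooth $\mathbb{T}^n$-invariant map with $\omega(\xi_N,\cdot)=d\mathbf{J}^\xi$ for all $\xi$, where $\mathbf{J}^\xi(p)=\langle\mathbf{J}(p),\xi\rangle$. $N^\circ$ is the (open, dense, connected) set of points where $\Phi$ is free. Exponential family. $\Omega$ carries the counting measure. $\mathcal{E}$ is the set of probability functions $p_\theta(x)=\exp\big(C(x)+\sum_{k=1}^n\theta_kF_k(x)-\psi(\theta)\big)$, $\theta\in\mathbb{R}^n$, where $C,F_1,\dots,F_n:\Omega\to\mathbb{R}$, $\psi:\mathbb{R}^n\to\mathbb{R}$, and $1,F_1,\dots,F_n$ are linearly independent; $\theta$ is a global chart of $\mathcal{E}$. $\mathbb{E}_p(X)=\sum_{x\in\Omega}X(x)p(x)$. $\mathcal{E}$ carries the Fisher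 metric $(h_F)_{ij}(\theta)=\mathbb{E}_{p_\theta}(\partial_i\ln p_\theta\,\partial_j\ln p_\theta)$ and the exponential connection $\nabla^{(e)}$, the flat connection for which $\theta_1,\dots,\theta_n$ are affine coordinates. $\mathcal{A}_{\mathcal{E}}$ is the real vector space of functions on $\Omega$ spanned by $F_1,\dots,F_n,1$. Torification. With coordinates $(\theta,\dot\theta)$ on $T\mathcal{E}$ (for the tangent vector $\sum_k\dot\theta_k\partial/\partial\theta_k$ at $p_\theta$), $T\mathcal{E}$ is a Kähler manifold with holomorphic coordinates $z_k=\theta_k+i\dot\theta_k$ and metric given by the block-diagonal matrix $\mathrm{diag}(h_F(\theta),h_F(\theta))$. A parallel lattice $L\subset T\mathcal{E}$ is the set of all integer combinations $\sum k_iY_i(p)$, $p\in\mathcal{E}$, of a frame $Y=(Y_1,\dots,Y_n)$ of $\nabla^{(e)}$-parallel vector fields on $\mathcal{E}$ (a generator of $L$). $\Gamma(L)\cong\mathbb{Z}^n$ is the group of maps $u\mapsto u+\sum k_iY_i$ of $T\mathcal{E}$; $\mathcal{E}_L=T\mathcal{E}/\Gamma(L)$ with its induced Kähler structure, $q_L:T\mathcal{E}\to\mathcal{E}_L$ is the quotient map, $\pi_L:\mathcal{E}_L\to\mathcal{E}$ the induced projection, and $\mathbb{T}^n$ acts on $\mathcal{E}_L$ by $\Phi_Y([t],q_L(u))=q_L(u+\sum t_iY_i)$. $(N,\Phi)$ is a torification of $\mathcal{E}$ if there are a parallel lattice $L$, a generator $Y$ and a holomorphic isometric diffeomorphism $G:\mathcal{E}_L\to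 N^\circ$ with $G\circ(\Phi_Y)_a=\Phi_a\circ G$ for all $a\in\mathbb{T}^n$. It is regular if $N$ is connected, simply connected, complete and has real-analytic Kähler metric. A compatible projection is a map $\kappa=\pi_L\circ G^{-1}:N^\circ\to\mathcal{E}$ for some such triple $(L,Y,G)$. Natural extension. $\mathcal{P}_m$ is the set of all probability functions on $\Omega$, with the topology of pointwise convergence, and $\overline{\mathcal{E}}$ is the closure of $\mathcal{E}$ in $\mathcal{P}_m$. Each compatible projection $\kappa$ has a unique continuous extension $K:N\to\overline{\mathcal{E}}$, called its natural extension. Kähler functions. A smooth $f:N\to\mathbb{R}$ is Kähler if its Hamiltonian vector field $X_f$ (defined by $\omega(X_f,\cdot)=df$) is Killing, i.e. $\mathscr{L}_{X_f}g=0$. $\mathrm{Aut}(N,g)$ is the group of holomorphic isometries of $N$ with the compact-open topology (a compact Lie group), $\mathrm{Aut}(N,g)^0$ its identity component. *)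

(* Defs.v *)
From HB Require Import structures.
From mathcomp Require Import all_boot all_order all_algebra.
From mathcomp Require Import generic_quotient.
From mathcomp Require Import all_classical all_reals all_analysis.

Set Implicit Arguments.
Unset Strict Implicit.
Unset Printing Implicit Defensive.

Import Order.TTheory GRing.Theory Num.Theory.
Import numFieldNormedType.Exports.

Local Open Scope classical_set_scope.
Local Open Scope ring_scope.
Local Open Scope quotient_scope.

(* C^oo on the open set U: every iterated directional derivative is (Frechet)
   differentiable at every point of U. *)
Definition smooth_on (R : realType) (V W : normedModType R) (U : set V)
    (f : V -> W) : Prop :=
  forall (vs : seq V) (x : V), U x ->
    differentiable (foldr (fun v (h : V -> W) => 'D_v h) f vs) x.

(* The power series is summed over the cubes {alpha | alpha_i < M}; the first
   conjunct is its absolute convergence. *)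
Definition analytic_at (R : realType) (m : nat) (f : 'rV[R]_m -> R)
    (x : 'rV[R]_m) : Prop :=
  exists (r : R) (a : ('I_m -> nat) -> R), 0 < r /\
    forall h : 'rV[R]_m, (forall i, `|h 0 i| < r) ->
    let term M (alpha : {ffun 'I_m -> 'I_M}) : R :=
      a (fun i => alpha i : nat) * \prod_(i < m) h 0 i ^+ alpha i in
    (exists B : R, forall M : nat, \sum_alpha `|term M alpha| <= B) /\
    ((\sum_alpha term M alpha) @[M --> \oo] --> f (x + h)).

(* C^n is modelled on row vectors (x, y) of length n + n, with z = x + iy. *)
Notation Cn R n := 'rV[R]_(n + n).

Definition mul_i (R : realType) (n : nat) (u : Cn R n) : Cn R n :=
  row_mx (- rsubmx u) (lsubmx u).

Record chart (R : realType) (n : nat) (T : Type) := Chart {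
  cdom : set T;
  cmap : T -> Cn R n;
  cinv : Cn R n -> T }.

Definition ccod (R : realType) (n : nat) (T : Type) (c : chart R n T) :
  set (Cn R n) := cmap c @` cdom c.

Definition is_chart (R : realType) (n : nat) (T : topologicalType)
    (c : chart R n T) : Prop :=
  [/\ open (cdom c), open (ccod c),
      (forall p, cdom c p -> cinv c (cmap c p) = p),
      (forall p, cdom c p -> {for p, continuous (cmap c)}) &
      (forall x, ccod c x -> {for x, continuous (cinv c)})].

(* Raw data of a complex manifold with a Riemannian metric; the axioms are in
   [is_kahler]. Each point p comes with a preferred chart [chart_at p], and
   the tangent space at p is identified with Cn R n through that chart. In this
   identification the complex structure is [mul_i] and [gram p] is the matrix
   of the metric. *)
Record kmanifold (R : realType) (n : nat) := KManifold {
  kcarrier :> topologicalType;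
  atlas : set (chart R n kcarrier);
  chart_at : kcarrier -> chart R n kcarrier;
  gram : kcarrier -> 'M[R]_(n + n) }.

Arguments atlas {R n} k _.

Section Geometry.
Variables (R : realType) (n : nat).
Implicit Types N M : kmanifold R n.

Definition coord_at N (p : N) : Cn R n := cmap (chart_at p) p.

Definition metric N (p : N) (u v : Cn R n) : R := (u *m gram p *m v^T) 0 0.

Definition kform N (p : N) (u v : Cn R n) : R := metric p (mul_i u) v.

(* Matrix of [b] in the (not necessarily preferred) chart c, at the point of
   coordinate x. *)
Definition in_chart N (b : N -> Cn R n -> Cn R n -> R) (c : chart R n N)
    (x u v : Cn R n) : R :=
  let p := cinv c x in
  let T := 'd (cmap (chart_at p) \o cinv c) x in
  b p (T u) (T v).

Definition holomorphic_on (U : set (Cn R n)) (f : Cn R n -> Cn R n) : Prop :=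
  smooth_on U f /\ forall x u, U x -> 'd f x (mul_i u) = mul_i ('d f x u).

Record is_kahler N : Prop := IsKahler {
  kahler_hausdorff : hausdorff_space N;
  kahler_second_countable : @second_countable N;
  kahler_atlas : forall c, atlas N c -> is_chart c;
  kahler_chart_at : forall p : N, atlas N (chart_at p) /\ cdom (chart_at p) p;
  kahler_transition : forall c c' : chart R n N, atlas N c -> atlas N c' ->
    holomorphic_on [set x | ccod c x /\ cdom c' (cinv c x)]
                   (cmap c' \o cinv c);
  kahler_smooth : forall (c : chart R n N) u v, atlas N c ->
    smooth_on (ccod c) (fun x => in_chart (@metric N) c x u v : R^o);
  kahler_sym : forall p : N, (gram p)^T = gram p;
  kahler_pos : forall (p : N) u, u != 0 -> 0 < metric p u u;
  kahler_hermitian : forall (p : N) u v,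
    metric p (mul_i u) (mul_i v) = metric p u v;
  kahler_closed : forall (c : chart R n N) x u v w, atlas N c -> ccod c x ->
    'D_u (fun y => in_chart (@kform N) c y v w : R^o) x +
    'D_v (fun y => in_chart (@kform N) c y w u : R^o) x +
    'D_w (fun y => in_chart (@kform N) c y u v : R^o) x = 0 }.

Definition smooth_map_on M N (U : set M) (f : M -> N) : Prop :=
  (forall p, U p -> {for p, continuous f}) /\
  forall (c : chart R n M) (c' : chart R n N), atlas M c -> atlas N c' ->
    smooth_on [set x | [/\ ccod c x, U (cinv c x) & cdom c' (f (cinv c x))]]
              (cmap c' \o f \o cinv c).

Definition tangent_map M N (f : M -> N) (p : M) : Cn R n -> Cn R n :=
  'd (cmap (chart_at (f p)) \o f \o cinv (chart_at p)) (coord_at p).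

(* f is a holomorphic isometric diffeomorphism of M onto the open subset U
   of N. *)
Definition holo_isometry M N (U : set N) (f : M -> N) : Prop :=
  [/\ smooth_map_on setT f,
      (exists f' : N -> M,
        [/\ smooth_map_on U f', (forall p, U (f p) /\ f' (f p) = p) &
            (forall q, U q -> f (f' q) = q)]),
      (forall p u, tangent_map f p (mul_i u) = mul_i (tangent_map f p u)) &
      (forall p u v,
        metric (f p) (tangent_map f p u) (tangent_map f p v) = metric p u v)].

Definition Aut N : set {compact-open, N -> N} :=
  [set f : N -> N | holo_isometry setT f].

Definition Aut0 N : set {compact-open, N -> N} :=
  connected_component (@Aut N) (idfun : N -> N).

Definition smooth_fun N (f : N -> R) : Prop :=
  forall c : chart R n N, atlas N c ->
    smooth_on (ccod c) (f \o cinv c : Cn R n -> R^o).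

Definition dfun N (f : N -> R) (p : N) : Cn R n -> R :=
  'd (f \o cinv (chart_at p) : Cn R n -> R^o) (coord_at p).

Definition grad N (f : N -> R) (p : N) : Cn R n :=
  xget 0 [set w | forall u, metric p w u = dfun f p u].

Definition hamiltonian N (f : N -> R) (p : N) : Cn R n :=
  xget 0 [set w | forall u, kform p w u = dfun f p u].

Definition field_in_chart N (X : N -> Cn R n) (c : chart R n N)
    (x : Cn R n) : Cn R n :=
  let p := cinv c x in
  'd (cmap c \o cinv (chart_at p)) (coord_at p) (X p).

(* L_X g = 0, evaluated in a chart on constant vector fields u, v. *)
Definition killing N (X : N -> Cn R n) : Prop :=
  forall (c : chart R n N) x u v, atlas N c -> ccod c x ->
    let g := in_chart (@metric N) c in
    let Xc := field_in_chart X c in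
    'D_(Xc x) (fun y => g y u v : R^o) x
      + g x ('D_u Xc x) v + g x u ('D_v Xc x) = 0.

Definition kahler_function N (f : N -> R) : Prop :=
  smooth_fun f /\ killing (hamiltonian f).

Definition smooth_curve N (gamma : R -> N) : Prop :=
  continuous gamma /\
  forall c : chart R n N, atlas N c ->
    smooth_on [set t : R^o | cdom c (gamma t)] (cmap c \o gamma).

Definition velocity N (gamma : R -> N) (t : R) : Cn R n :=
  'D_(1 : R^o) (cmap (chart_at (gamma t)) \o gamma : R^o -> Cn R n) t.

Definition curve_length N (gamma : R -> N) : \bar R :=
  (\int[lebesgue_measure]_(t in `[0%R, 1%R])
     (Num.sqrt (metric (gamma t) (velocity gamma t) (velocity gamma t)))%:E)%E.

Definition riemannian_dist N (p q : N) : \bar R :=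
  ereal_inf [set curve_length gamma | gamma in
    [set gamma : R -> N |
      [/\ smooth_curve gamma, gamma 0 = p & gamma 1 = q]]].

Definition complete_metric N : Prop :=
  forall u : nat -> N,
    (forall e : R, 0 < e -> exists k : nat, forall i j : nat,
       (k <= i)%N -> (k <= j)%N -> (riemannian_dist (u i) (u j) < e%:E)%E) ->
    exists p : N, u @ \oo --> p.

Definition analytic_metric N : Prop :=
  forall (c : chart R n N) x u v, atlas N c -> ccod c x ->
    analytic_at (fun y => in_chart (@metric N) c y u v) x.

End Geometry.

Arguments Aut {R n} N _.
Arguments Aut0 {R n} N _.

Definition simply_connected (R : realType) (T : topologicalType) : Prop :=
  connected [set: T] /\
  forall gamma : R -> T,
    {within `[0, 1], continuous gamma} -> gamma 0 = gamma 1 ->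
    exists H : R * R -> T,
      [/\ {within `[0, 1] `*` `[0, 1], continuous H},
          (forall s : R, s \in `[0, 1] -> H (s, 0) = gamma s),
          (forall s : R, s \in `[0, 1] -> H (s, 1) = gamma 0) &
          (forall t : R, t \in `[0, 1] -> H (0, t) = gamma 0 /\ H (1, t) = gamma 0)].

Section Torus.
Variables (R : realType) (n : nat).

Definition torus_rel (s t : 'rV[R]_n) : bool :=
  [forall i, (s - t) 0 i \is a Num.int].

Lemma torus_rel_refl : reflexive torus_rel.
Proof. by move=> s; apply/forallP => i; rewrite subrr mxE rpred0. Qed.

Lemma torus_rel_sym : symmetric torus_rel.
Proof.
by move=> s t; apply/eq_forallb => i; rewrite -opprB mxE rpredN.
Qed.

Lemma torus_rel_trans : transitive torus_rel.
Proof.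
move=> t s u /forallP st /forallP tu; apply/forallP => i.
by rewrite -(subrKA t) mxE rpredD.
Qed.

Canonical torus_equiv :=
  EquivRel torus_rel torus_rel_refl torus_rel_sym torus_rel_trans.

Definition torus := {eq_quot torus_equiv}.

Definition tclass (t : 'rV[R]_n) : torus := \pi_torus t.

(* Smoothness of an action on T^n x N is tested on the lift to R^n x N. *)
Record is_smooth_action (N : kmanifold R n) (Phi : torus -> N -> N) : Prop :=
  IsSmoothAction {
    action0 : forall p, Phi (tclass 0) p = p;
    actionD : forall s t p,
      Phi (tclass (s + t)) p = Phi (tclass s) (Phi (tclass t) p);
    action_continuous :
      continuous (fun z : 'rV[R]_n * N => Phi (tclass z.1) z.2);
    action_smooth : forall c c' : chart R n N, atlas N c -> atlas N c' ->
      smooth_on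
        [set z : 'rV[R]_n * Cn R n |
           ccod c z.2 /\ cdom c' (Phi (tclass z.1) (cinv c z.2))]
        (fun z => cmap c' (Phi (tclass z.1) (cinv c z.2))) }.

Definition fundamental_field (N : kmanifold R n) (Phi : torus -> N -> N)
    (xi : 'rV[R]_n) (p : N) : Cn R n :=
  'D_(1 : R^o)
    (fun t : R^o => cmap (chart_at p) (Phi (tclass (t *: xi)) p)) 0.

Definition is_momentum_map (N : kmanifold R n) (Phi : torus -> N -> N)
    (J : N -> 'rV[R]_n) : Prop :=
  let Jxi (xi : 'rV[R]_n) (p : N) : R := (J p *m xi^T) 0 0 in
  [/\ (forall c : chart R n N, atlas N c -> smooth_on (ccod c) (J \o cinv c)),
      (forall a p, J (Phi a p) = J p) &
      (forall xi p u, kform p (fundamental_field Phi xi p) u =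
                      dfun (Jxi xi) p u)].

Record kahler_toric (N : kmanifold R n) (Phi : torus -> N -> N) : Prop :=
  KahlerToric {
    toric_kahler : is_kahler N;
    toric_connected : connected [set: N];
    toric_compact : compact [set: N];
    toric_action : is_smooth_action Phi;
    toric_effective : forall a, (forall p, Phi a p = p) -> a = tclass 0;
    toric_isometric : forall a, holo_isometry setT (Phi a);
    toric_momentum : exists J : N -> 'rV[R]_n, is_momentum_map Phi J }.

Definition free_points (N : kmanifold R n) (Phi : torus -> N -> N) : set N :=
  [set p | forall a, Phi a p = p -> a = tclass 0].

End Torus.

Definition prob_mean (R : realType) (Omega : finType) (q X : Omega -> R) : R :=
  \sum_x X x * q x.

Definition prob_var (R : realType) (Omega : finType) (q X : Omega -> R) : R :=
  prob_mean q (fun x => (X x - prob_mean q X) ^+ 2).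

Record exp_family (R : realType) (n : nat) (Omega : finType) := ExpFamily {
  ef_C : Omega -> R;
  ef_F : 'I_n -> Omega -> R;
  ef_psi : 'rV[R]_n -> R;
  ef_normalized : forall theta : 'rV[R]_n,
    \sum_x expR (ef_C x + \sum_k theta 0 k * ef_F k x - ef_psi theta) = 1;
  ef_independent : forall (b : R) (a : 'I_n -> R),
    (forall x, \sum_k a k * ef_F k x + b = 0) -> b = 0 /\ forall k, a k = 0 }.

Section ExpFamily.
Variables (R : realType) (n : nat) (Omega : finType).
Variable E : exp_family R n Omega.

Definition ef_prob (theta : 'rV[R]_n) (x : Omega) : R :=
  expR (ef_C E x + \sum_k theta 0 k * ef_F E k x - ef_psi E theta).

Definition ef_score (theta : 'rV[R]_n) (i : 'I_n) (x : Omega) : R :=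
  'D_(delta_mx 0 i) (fun t : 'rV[R]_n => ln (ef_prob t x) : R^o) theta.

Definition fisher (theta : 'rV[R]_n) : 'M[R]_n :=
  \matrix_(i, j) prob_mean (ef_prob theta)
                   (fun x => ef_score theta i x * ef_score theta j x).

Definition ef_span : set (Omega -> R) :=
  [set X | exists (a : 'I_n -> R) (b : R),
     forall x, X x = \sum_k a k * ef_F E k x + b].

Definition prob_functions : set {ptws Omega -> R} :=
  [set q : Omega -> R | (forall x, 0 <= q x) /\ \sum_x q x = 1].

Definition ef_closure : set {ptws Omega -> R} :=
  prob_functions `&` closure (range ef_prob : set {ptws Omega -> R}).

End ExpFamily.

(* A frame is given by its matrix in the coordinates theta: the rows of Y theta
   are the components of Y_1, ..., Y_n at p_theta. The Christoffel symbols of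
   the exponential connection vanish in these coordinates. *)
Definition parallel_frame (R : realType) (n : nat)
    (Y : 'rV[R]_n -> 'M[R]_n) : Prop :=
  [/\ (forall theta, differentiable Y theta),
      (forall theta v, 'D_v Y theta = 0) &
      (forall theta, Y theta \in unitmx)].

Section Quotient.
Variables (R : realType) (n : nat) (Y : 'rV[R]_n -> 'M[R]_n).

(* A point of the tangent bundle is a pair (theta, theta-dot) : Cn R n. *)
Definition translate (t : 'rV[R]_n) (u : Cn R n) : Cn R n :=
  row_mx (lsubmx u) (rsubmx u + t *m Y (lsubmx u)).

Definition int_vec (k : 'rV[int]_n) : 'rV[R]_n := map_mx intr k.

Definition lattice_rel (u v : Cn R n) : bool :=
  `[< exists k : 'rV[int]_n, v = translate (int_vec k) u >].

Lemma translateD s t u : translate s (translate t u) = translate (s + t) u.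
Proof.
by rewrite /translate row_mxKl row_mxKr mulmxDl addrAC -addrA.
Qed.

Lemma translate0 u : translate 0 u = u.
Proof. by rewrite /translate mul0mx addr0 hsubmxK. Qed.

Lemma int_vecD k l : int_vec (k + l) = int_vec k + int_vec l.
Proof. exact: map_mxD. Qed.

Lemma lattice_rel_refl : reflexive lattice_rel.
Proof.
by move=> u; apply/asboolP; exists 0; rewrite /int_vec map_mx0 translate0.
Qed.

Lemma lattice_rel_sym : symmetric lattice_rel.
Proof.
have H u v : lattice_rel u v -> lattice_rel v u.
  move=> /asboolP[k ->]; apply/asboolP; exists (- k).
  by rewrite translateD -int_vecD addNr /int_vec map_mx0 translate0.
by move=> u v; apply/idP/idP; exact: H.
Qed.

Lemma lattice_rel_trans : transitive lattice_rel.
Proof.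
move=> v u w /asboolP[k ->] /asboolP[l ->]; apply/asboolP; exists (l + k).
by rewrite translateD int_vecD.
Qed.

Canonical lattice_equiv :=
  EquivRel lattice_rel lattice_rel_refl lattice_rel_sym lattice_rel_trans.

Definition tquot := quotient_topology {eq_quot lattice_equiv}.

Definition qL (u : Cn R n) : tquot := \pi_tquot u.

Definition piL (e : tquot) : 'rV[R]_n := lsubmx (repr e).

(* An open set around u0 on which qL is injective. *)
Definition tquot_nbhs (u0 : Cn R n) : set (Cn R n) :=
  [set u | exists t : 'rV[R]_n, (forall i, `|t 0 i| < 2^-1) /\
     rsubmx u = rsubmx u0 + t *m Y (lsubmx u)].

Definition tquot_chart (u0 : Cn R n) : chart R n tquot :=
  {| cdom := qL @` tquot_nbhs u0;
     cmap := fun e => xget u0 [set u | tquot_nbhs u0 u /\ qL u = e];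
     cinv := qL |}.

Definition tquot_action (a : torus R n) (e : tquot) : tquot :=
  qL (translate (repr a) (repr e)).

Lemma qL_translate_int k u : qL (translate (int_vec k) u) = qL u.
Proof. by apply/esym/eqmodP/asboolP; exists k. Qed.

Lemma tquot_actionE t u :
  tquot_action (tclass t) (qL u) = qL (translate t u).
Proof.
rewrite /tquot_action.
have /eqmodP/asboolP[k] : repr (qL u) = u %[mod {eq_quot lattice_equiv}].
  exact: (reprK (qL u)).
move: (repr (qL u)) => w ->.
have /eqmodP/forallP ht : t = repr (tclass t) %[mod torus R n].
  by rewrite reprK.
move: (repr (tclass t)) ht => s ht.
pose l : 'rV[int]_n := map_mx Num.floor (t - s).
have <- : int_vec l + s = t.
  apply/rowP => i; have := ht i; rewrite !mxE intrEfloor => /eqP ->.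
  by rewrite addrNK.
rewrite translateD -addrA [s + _]addrC addrA -int_vecD -translateD.
by rewrite qL_translate_int.
Qed.

Lemma piLE u : piL (qL u) = lsubmx u.
Proof.
rewrite /piL.
have /eqmodP/asboolP[k] : repr (qL u) = u %[mod {eq_quot lattice_equiv}].
  exact: (reprK (qL u)).
by move: (repr (qL u)) => w ->; rewrite row_mxKl.
Qed.

End Quotient.

(* The charts are local inverses of qL, so the tangent coordinates are those of
   (theta, theta-dot). *)
Definition quotient_kmanifold (R : realType) (n : nat) (Omega : finType)
    (E : exp_family R n Omega) (Y : 'rV[R]_n -> 'M[R]_n) : kmanifold R n :=
  {| kcarrier := tquot Y;
     atlas := range (tquot_chart Y);
     chart_at := fun e => tquot_chart Y (repr e);
     gram := fun e => block_mx (fisher E (piL e)) 0 0 (fisher E (piL e)) |}.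

Section Torification.
Variables (R : realType) (n : nat) (Omega : finType).
Variables (E : exp_family R n Omega) (N : kmanifold R n).
Variable Phi : torus R n -> N -> N.

(* The lattice L of a triple (L, Y, G) is the one generated by Y. *)
Definition torification_data (Y : 'rV[R]_n -> 'M[R]_n)
    (G : quotient_kmanifold E Y -> N) : Prop :=
  [/\ parallel_frame Y, holo_isometry (free_points Phi) G &
      (forall a e, G (tquot_action a e) = Phi a (G e))].

Definition torification : Prop :=
  exists Y (G : quotient_kmanifold E Y -> N), torification_data G.

Definition regular_torification : Prop :=
  [/\ torification, connected [set: N], simply_connected R N,
      complete_metric N & analytic_metric N].

(* Only the values of kappa on the set of free points matter. *)
Definition compatible_projection (kappa : N -> Omega -> R) : Prop :=
  exists Y (G : quotient_kmanifold E Y -> N), torification_data G /\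
    forall e, kappa (G e) = ef_prob E (piL e).

Definition natural_extension (K : N -> Omega -> R) : Prop :=
  exists2 kappa : N -> Omega -> R, compatible_projection kappa &
    [/\ continuous (K : N -> {ptws Omega -> R}),
        (forall p, ef_closure E (K p)) &
        (forall p, free_points Phi p -> K p = kappa p)].

End Torification.

(* Main.v *)
Require Import Defs.
From HB Require Import structures.
From mathcomp Require Import all_boot all_order all_algebra.
From mathcomp Require Import generic_quotient.
From mathcomp Require Import all_classical all_reals all_analysis.
From mathcomp Require Import ring lra.

Set Implicit Arguments.
Unset Strict Implicit.
Unset Printing Implicit Defensive.

Import Order.TTheory GRing.Theory Num.Theory.
Import numFieldNormedType.Exports.

Local Open Scope classical_set_scope.
Local Open Scope ring_scope.

(** On the set of free points the torification identifies N with the quotient of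
    the tangent bundle of E, where f is theta |-> E_theta(X).  If X is
    sum_k a_k F_k + b, its gradient there is the constant field (a, 0), whose
    squared norm a h_F a^T is the variance of X; a holomorphic isometry phi does
    not change this.  Both sides of the identity are continuous, so it remains to
    see that the free points are dense.  A nontrivial closed subgroup of a torus
    has a nontrivial torsion element, so the complement of the free points is a
    countable union of fixed-point sets of torsion elements.  Such a set has empty
    interior: a map of finite order whose differential at a fixed point is the
    identity is locally the identity, hence the interior of the fixed-point set
    is closed, and effectiveness applies.  Baire's theorem concludes. *)

(** * Locality of differentials, and calculus on row vectors *)

Section NearEqual.
Variables (R : numFieldType) (V W : normedModType R).

(** The first-order expansion of [f] at [x] is also one of [g], and such an expansion determines the
    differential. *)
Lemma near_eq_diff (f g : V -> W) (x : V) :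
  (\near x, f x = g x) -> differentiable f x ->
  differentiable g x /\ 'd g x = 'd f x :> (V -> W).
Proof.
move=> fg df; have fgx : f x = g x := nbhs_singleton fg.
have dg : g \o shift x = cst (g x) + 'd f x +o_0 id.
  apply/eqaddoP => e e0.
  have /eqaddoP/(_ _ e0) := diff_locally df.
  have fg0 : \forall y \near (0 : V), f (y + x) = g (y + x).
    have : (fun y : V => y + x) @ (0 : V) --> 0 + x.
      by apply: cvgD; [exact: cvg_id | exact: cvg_cst].
    by rewrite add0r => /(_ _ fg).
  by apply: filterS2 fg0 => y /= fgy; rewrite /= !fctE /= fgy fgx.
have E : 'd g x = 'd f x :> (V -> W).
  by rewrite (diff_unique (diff_continuous df) dg).
split=> //; apply/diff_locallyP; rewrite E; split=> //.
exact: diff_continuous.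
Qed.

End NearEqual.

Lemma is_derive_comp_real (R : realType) (V : normedModType R) (f : V -> R^o)
    (g : R^o -> R^o) (dg : R) (x v : V) :
  differentiable f x -> is_derive (f x) 1 g dg ->
  differentiable (g \o f) x /\ 'D_v (g \o f) x = dg * 'D_v f x.
Proof.
move=> df [/derivable1_diffP dgd gE].
have dgf : differentiable (g \o f) x by exact: differentiable_comp.
split=> //; rewrite !deriveE// diff_comp//= -[X in 'd _ _ X]mulr1.
by rewrite [LHS]linearZ /= mulrC -gE deriveE.
Qed.

Section RowVectors.
Variables (R : realType) (n : nat).

(** In finite dimension a linear form is a finite combination of coordinate functions. *)
Lemma continuous_linear_row (f : {linear 'rV[R]_n -> R^o}) : continuous f.
Proof.
have fE : f = \sum_k (f (delta_mx 0 k) *: (fun t : 'rV[R]_n => t 0 k : R^o))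
    :> ('rV[R]_n -> R^o).
  apply/funext => t; rewrite fct_sumE {1}(row_sum_delta t) linear_sum.
  by apply: eq_bigr => k _; rewrite linearZ; exact: mulrC.
move=> t; rewrite fE; apply: differentiable_continuous.
apply: differentiable_sum => k; apply: differentiableZ.
exact: differentiable_coord.
Qed.

Lemma diff_row_sum (W : normedModType R) (f : 'rV[R]_n -> W) (x v : 'rV[R]_n) :
  differentiable f x ->
  'd f x v = \sum_k v 0 k *: 'D_(delta_mx 0 k) f x.
Proof.
move=> df; rewrite {1}(row_sum_delta v) linear_sum.
by apply: eq_bigr => k _; rewrite linearZ /= deriveE.
Qed.

End RowVectors.

(** Lets sums over [Omega] be indexed by ordinals, the shape on which [differentiable_sum] and
    [derive_sum] are used. *)
Lemma sum_enum_val (M : nmodType) (T : finType) (F : T -> M) :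
  \sum_(i < #|T|) F (enum_val i) = \sum_x F x.
Proof. by rewrite -(big_enum_val F); apply: eq_bigl. Qed.

(** Bilinearity of the mean: with [s] the score, the left side is the Fisher form of [u] and [v]. *)
Lemma sum_mean_mul (R : realType) (n : nat) (Omega : finType)
    (s : 'I_n -> Omega -> R) (q : Omega -> R) (u v : 'rV[R]_n) :
  \sum_j (\sum_i u 0 i * prob_mean q (fun x => s i x * s j x)) * v 0 j =
  prob_mean q (fun x => (\sum_k u 0 k * s k x) * (\sum_k v 0 k * s k x)).
Proof.
rewrite /prob_mean; under eq_bigr do rewrite mulr_suml.
rewrite exchange_big /=.
under [RHS]eq_bigr do rewrite big_distrlr /= mulr_suml.
rewrite [RHS]exchange_big /=; apply: eq_bigr => i _.
under [RHS]eq_bigr do rewrite mulr_suml.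
rewrite [RHS]exchange_big /=; apply: eq_bigr => j _.
rewrite mulr_sumr mulr_suml; apply: eq_bigr => x _.
by ring.
Qed.

(** * Exponential families: scores, the Fisher metric, means and variances *)

Section ExponentialFamily.
Variables (R : realType) (n : nat) (Omega : finType) (E : exp_family R n Omega).
Implicit Types (theta v : 'rV[R]_n) (x : Omega).

Definition ef_lin x theta : R^o := \sum_k theta 0 k * ef_F E k x.

Fact ef_lin_is_linear x : linear (ef_lin x).
Proof.
move=> c u v; rewrite /ef_lin scaler_sumr -big_split /=; apply: eq_bigr => k _.
by rewrite !mxE mulrDl -mulrA.
Qed.
HB.instance Definition _ x := GRing.isLinear.Build R 'rV[R]_n R^o _ (ef_lin x)
  (ef_lin_is_linear x).

Lemma differentiable_ef_lin x theta : differentiable (ef_lin x) theta.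
Proof. exact/linear_differentiable/continuous_linear_row. Qed.

Lemma derive_ef_lin x theta v : 'D_v (ef_lin x) theta = ef_lin x v.
Proof.
rewrite deriveE; last exact: differentiable_ef_lin.
by rewrite diff_lin//; exact: continuous_linear_row.
Qed.

Definition ef_weight x theta : R^o := expR (ef_C E x + ef_lin x theta).

Lemma differentiable_ef_weight x theta : differentiable (ef_weight x) theta.
Proof.
apply: (@differentiable_comp _ _ _ _ (cst (ef_C E x : R^o) + ef_lin x)
  (expR : R^o -> R^o)).
  apply: differentiableD; first exact: differentiable_cst.
  exact: differentiable_ef_lin.
exact/derivable1_diffP.
Qed.

(** Normalisation forces [ef_psi] to be the logarithm of the partition function; its
    differentiability is obtained from this formula. *)
Lemma ef_psiE theta : ef_psi E theta = ln (\sum_x ef_weight x theta).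
Proof.
have -> : \sum_x ef_weight x theta = expR (ef_psi E theta).
  rewrite -[RHS]mul1r -(ef_normalized E theta) mulr_suml.
  by apply: eq_bigr => x _; rewrite -expRD subrK.
by rewrite expRK.
Qed.

(** An empty sum of probabilities cannot be 1. This makes the partition function positive, so that
    its logarithm is differentiable. *)
Lemma ef_point : exists x : Omega, True.
Proof.
apply: contrapT => h; have := ef_normalized E 0.
rewrite big1 => [|x]; first by move/eqP; rewrite eq_sym oner_eq0.
by case: h; exists x.
Qed.

Lemma differentiable_ef_psi theta : differentiable (ef_psi E : _ -> R^o) theta.
Proof.
have -> : (ef_psi E : _ -> R^o) =
    (@ln R : R^o -> R^o) \o (fun t => \sum_x ef_weight x t : R^o).
  by apply/funext => t; rewrite /= ef_psiE.
apply: differentiable_comp.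
  have -> : (fun t => \sum_x ef_weight x t : R^o) =
            \sum_(i < #|Omega|) ef_weight (enum_val i).
    by apply/funext => t; rewrite fct_sumE (sum_enum_val (ef_weight ^~ t)).
  by apply: differentiable_sum => i; exact: differentiable_ef_weight.
apply/derivable1_diffP.
have /is_derive1_ln[]// : 0 < \sum_x ef_weight x theta.
have [x _] := ef_point.
rewrite (bigD1 x)//= ltr_pwDl ?expR_gt0// sumr_ge0// => y _.
exact: expR_ge0.
Qed.

Lemma ef_scoreE theta i x :
  ef_score E theta i x =
  ef_F E i x - 'D_(delta_mx 0 i) (ef_psi E : _ -> R^o) theta.
Proof.
rewrite /ef_score.
have -> : (fun t : 'rV[R]_n => ln (ef_prob E t x) : R^o) =
   (cst (ef_C E x : R^o) + ef_lin x) - (ef_psi E : _ -> R^o).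
  by apply/funext => t; rewrite /ef_prob expRK.
have d1 := @differentiable_ef_lin x theta.
have d2 := @differentiable_ef_psi theta.
have dc := differentiable_cst (ef_C E x : R^o) theta.
rewrite deriveB; [|exact/diff_derivable/differentiableD|exact: diff_derivable].
rewrite deriveD; [|exact: diff_derivable|exact: diff_derivable].
rewrite derive_cst add0r derive_ef_lin /ef_lin (bigD1 i)//= big1 => [|k ki].
  by rewrite addr0 mxE !eqxx mul1r.
by rewrite mxE eqxx (negPf ki) mul0r.
Qed.

Lemma ef_prob_derive x theta :
  differentiable (ef_prob E ^~ x : _ -> R^o) theta /\
  forall i, 'D_(delta_mx 0 i) (ef_prob E ^~ x : _ -> R^o) theta =
    ef_prob E theta x * ef_score E theta i x.
Proof.
pose l : 'rV[R]_n -> R^o := fun t => ln (ef_prob E t x).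
have lE : l = (cst (ef_C E x : R^o) + ef_lin x) - (ef_psi E : _ -> R^o).
  by apply/funext => t; rewrite /l /ef_prob expRK.
have dl : differentiable l theta.
  rewrite lE; apply: differentiableB; last exact: differentiable_ef_psi.
  apply: differentiableD; first exact: differentiable_cst.
  exact: differentiable_ef_lin.
have -> : (ef_prob E ^~ x : _ -> R^o) = (expR : R^o -> R^o) \o l.
  by apply/funext => t; rewrite lE.
have D := is_derive_expR (l theta).
split=> [|i]; first by have [] := is_derive_comp_real 0 dl D.
have [_ ->] := is_derive_comp_real (delta_mx 0 i) dl D.
by rewrite [in expR _]/l lnK// posrE expR_gt0.
Qed.

Lemma ef_mean_derive (X : Omega -> R) theta :
  differentiable (fun t => prob_mean (ef_prob E t) X : R^o) theta /\
  forall i, 'D_(delta_mx 0 i) (fun t => prob_mean (ef_prob E t) X : R^o) theta =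
    prob_mean (ef_prob E theta) (fun x => X x * ef_score E theta i x).
Proof.
have mE : (fun t => prob_mean (ef_prob E t) X : R^o) =
   \sum_(j < #|Omega|)
     (X (enum_val j) *: (ef_prob E ^~ (enum_val j) : _ -> R^o)).
  apply/funext => t; rewrite fct_sumE /prob_mean.
  by rewrite (sum_enum_val (fun x => X x * ef_prob E t x)).
have dp x := (@ef_prob_derive x theta).1.
split.
  by rewrite mE; apply: differentiable_sum => j; exact: differentiableZ.
move=> i; rewrite mE derive_sum => [|j]; last first.
  exact/diff_derivable/differentiableZ.
rewrite (eq_bigr (fun j => X (enum_val j) *
    (ef_prob E theta (enum_val j) * ef_score E theta i (enum_val j)))).
  rewrite (sum_enum_val
    (fun x => X x * (ef_prob E theta x * ef_score E theta i x))) /prob_mean.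
  by apply: eq_bigr => x _; rewrite mulrA mulrAC.
move=> j _; rewrite deriveZ; last exact: diff_derivable.
by rewrite (ef_prob_derive _ _).2.
Qed.

Definition ef_lin_score theta v x : R := \sum_k v 0 k * ef_score E theta k x.

Lemma ef_prob_mean1 theta : prob_mean (ef_prob E theta) (fun=> 1) = 1.
Proof.
by rewrite -[RHS](ef_normalized E theta); apply: eq_bigr => x _; rewrite mul1r.
Qed.

(** Differentiate the constant total mass 1 under the sum. *)
Lemma mean_ef_score theta i :
  prob_mean (ef_prob E theta) (ef_score E theta i) = 0.
Proof.
have [_ /(_ i)] := ef_mean_derive (fun=> 1) theta.
have -> : (fun t => prob_mean (ef_prob E t) (fun=> 1) : R^o) = cst 1.
  by apply/funext => t; rewrite ef_prob_mean1.
rewrite derive_cst => ->.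
by apply: eq_bigr => x _; rewrite mul1r.
Qed.

Lemma mean_ef_lin_score theta v :
  prob_mean (ef_prob E theta) (ef_lin_score theta v) = 0.
Proof.
rewrite /prob_mean /ef_lin_score.
under eq_bigr do rewrite mulr_suml.
rewrite exchange_big big1//= => k _.
under eq_bigr do rewrite -mulrA.
by rewrite -mulr_sumr [X in _ * X]mean_ef_score mulr0.
Qed.

Lemma fisher_mean theta u v : (u *m fisher E theta *m v^T) 0 0 =
  prob_mean (ef_prob E theta)
    (fun x => ef_lin_score theta u x * ef_lin_score theta v x).
Proof.
rewrite /ef_lin_score -sum_mean_mul mxE; apply: eq_bigr => j _; rewrite !mxE.
by congr (_ * _); apply: eq_bigr => i _; rewrite mxE.
Qed.

Lemma ef_prob_gt0 theta x : 0 < ef_prob E theta x.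
Proof. exact: expR_gt0. Qed.

Lemma fisher_ge0 theta v : 0 <= (v *m fisher E theta *m v^T) 0 0.
Proof.
rewrite fisher_mean; apply: sumr_ge0 => x _.
by rewrite mulr_ge0 ?(ltW (ef_prob_gt0 _ _))// -expr2 sqr_ge0.
Qed.

(** All probabilities are positive, so a null vector [v] makes its linear score vanish at every
    point. By [ef_scoreE] this is an affine relation among the [ef_F E k], and [ef_independent]
    gives [v = 0]. *)
Lemma fisher_definite theta v : (v *m fisher E theta *m v^T) 0 0 = 0 -> v = 0.
Proof.
rewrite fisher_mean /prob_mean => /eqP.
rewrite psumr_eq0 => [/allP v0|x _]; last first.
  by rewrite mulr_ge0 ?(ltW (ef_prob_gt0 _ _))// -expr2 sqr_ge0.
have {}v0 x : ef_lin_score theta v x = 0.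
  have /eqP := v0 x (mem_index_enum _).
  by move/eqP; rewrite !mulf_eq0 orbb (gt_eqF (ef_prob_gt0 _ _)) orbF => /eqP.
have [|_ a0] := @ef_independent _ _ _ E
  (- \sum_k v 0 k * 'D_(delta_mx 0 k) (ef_psi E : _ -> R^o) theta) (v 0);
  last by apply/rowP => k; rewrite a0 mxE.
move=> x; rewrite -[RHS](v0 x) -sumrB; apply: eq_bigr => k _.
by rewrite ef_scoreE mulrBr.
Qed.

(** Up to a constant depending on [theta], X is the linear score of its coefficient vector. Since
    scores are centred, this yields both the variance of X and the derivative of its mean. *)
Lemma ef_span_score (X : Omega -> R) (a : 'I_n -> R) (b : R) theta :
  (forall x, X x = \sum_k a k * ef_F E k x + b) ->
  exists c, forall x, X x = ef_lin_score theta (\row_k a k) x + c.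
Proof.
move=> XE.
exists (\sum_k a k * 'D_(delta_mx 0 k) (ef_psi E : _ -> R^o) theta + b) => x.
rewrite XE addrA -big_split /=; congr (_ + _); apply: eq_bigr => k _.
by rewrite ef_scoreE mxE mulrBr subrK.
Qed.

Lemma ef_span_var (X : Omega -> R) (a : 'I_n -> R) (b : R) theta :
  (forall x, X x = \sum_k a k * ef_F E k x + b) ->
  prob_var (ef_prob E theta) X =
  ((\row_k a k) *m fisher E theta *m (\row_k a k)^T) 0 0.
Proof.
move=> /(ef_span_score theta)[c XE].
have mX : prob_mean (ef_prob E theta) X = c.
  rewrite /prob_mean; under eq_bigr do rewrite XE mulrDl.
  rewrite big_split /= [X in X + _]mean_ef_lin_score add0r -mulr_sumr.
  by rewrite (_ : \sum_i _ = 1) ?mulr1// -[RHS](ef_normalized E theta).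
rewrite /prob_var mX fisher_mean; apply: eq_bigr => x _.
by rewrite XE addrK expr2.
Qed.

(** The derivative of the mean is the covariance of X with the score. The formula says that the
    Fisher gradient of the mean of X is the constant vector [a]. *)
Lemma ef_span_diff_mean (X : Omega -> R) (a : 'I_n -> R) (b : R) theta v :
  (forall x, X x = \sum_k a k * ef_F E k x + b) ->
  'd (fun t => prob_mean (ef_prob E t) X : R^o) theta v =
  ((\row_k a k) *m fisher E theta *m v^T) 0 0.
Proof.
move=> /(ef_span_score theta)[c XE].
have [dm mE] := ef_mean_derive X theta.
rewrite diff_row_sum// fisher_mean.
under eq_bigr do rewrite mE.
rewrite [LHS](_ : _ = prob_mean (ef_prob E theta)
  (fun x => X x * ef_lin_score theta v x)).
  rewrite /prob_mean; under eq_bigr do rewrite XE mulrDl mulrDl.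
  rewrite big_split /= [X in _ + X](_ : _ = 0) ?addr0//.
  under eq_bigr do rewrite -mulrA.
  by rewrite -mulr_sumr [X in _ * X]mean_ef_lin_score mulr0.
rewrite /prob_mean /ef_lin_score.
under [RHS]eq_bigr do rewrite mulr_sumr mulr_suml.
rewrite exchange_big /=; apply: eq_bigr => k _.
rewrite [LHS]mulr_sumr; apply: eq_bigr => x _.
by rewrite -!mulrA mulrCA.
Qed.

End ExponentialFamily.

(** * Closed subgroups of the torus and their torsion elements *)

Section TorusSubgroups.
Variables (R : realType) (n : nat).
Implicit Types (x y z : 'rV[R]_n).

(** The lattice of periods: [tclass t = tclass 0] exactly for these rows. *)
Definition integral_row x := forall i, x 0 i \is a Num.int.

Lemma integral_rowB x y :
  integral_row x -> integral_row y -> integral_row (x - y).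
Proof. by move=> ix iy i; rewrite !mxE rpredB. Qed.

Lemma row_norm_le x (e : R) : 0 <= e -> (forall i, `|x 0 i| <= e) -> `|x| <= e.
Proof.
move=> e0 xe; rewrite /Num.Def.normr/= mx_normrE.
by apply: bigmax_le => //= -[i j] _ /=; rewrite ord1.
Qed.

Lemma row_norm_ge x i : `|x 0 i| <= `|x|.
Proof.
rewrite [leRHS]/Num.Def.normr/= mx_normrE.
exact: (le_bigmax _ (fun ij : 'I_1 * 'I_n => `|x ij.1 ij.2|) (0, i)).
Qed.

(** Qualitative form of Dirichlet's theorem. The fractional parts of the multiples of [x] lie in the
    compact unit cube, so they accumulate at some [c]; two of them near [c] are close to each other,
    and [k] is the difference of their indices. *)
Lemma simultaneous_approximation x (e : R) : 0 < e ->
  exists (k : nat) (m : 'rV[R]_n),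
    [/\ (0 < k)%N, integral_row m & `|x *+ k - m| < e].
Proof.
move=> e0.
pose fl (y : 'rV[R]_n) : 'rV[R]_n := \row_i (Num.floor (y 0 i))%:~R.
pose u (k : nat) : 'rV[R]_n := x *+ k - fl (x *+ k).
have flI y : integral_row (fl y) by move=> i; rewrite mxE intr_int.
have cK := @rV_compact R n (fun=> `[0, 1]%classic)
  (fun=> @segment_compact R 0 1).
have uK : (u @ \oo) [set v | forall i, `[0, 1]%classic (v ord0 i)].
  exists 0%N => // k _ i; rewrite /= in_itv /= !mxE subr_ge0.
  have /andP[-> /ltW] /= := floor_itv ((x *+ k) 0 i).
  by rewrite lerBlDl intrD.
have [c [_ uc]] := cK (u @ \oo) _ uK.
have e2 : 0 < e / 2 by rewrite divr_gt0.
have far (k0 : nat) : exists2 k : nat, (k0 < k)%N & ball c (e / 2) (u k).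
  have [|_ [[k kk0 <-]]] := uc (u @` [set k | (k0 < k)%N]) _ _
    (nbhsx_ballx c _ e2); last by exists k.
  by exists k0.+1 => // k /= kk0; exists k.
have [k _ ck] := far 0%N; have [k' kk' ck'] := far k.
exists (k' - k)%N, (fl (x *+ k') - fl (x *+ k)); split.
- by rewrite subn_gt0.
- exact: integral_rowB.
- move: ck ck'; rewrite -ball_normE /= => ck ck'.
  have -> : x *+ (k' - k) - (fl (x *+ k') - fl (x *+ k)) =
            (c - u k) - (c - u k').
    rewrite /u mulrnBr ?(ltnW kk')//; apply/rowP => i.
    by rewrite !mxE; ring.
  by rewrite (le_lt_trans (ler_normB _ _))// [e]splitr ltrD.
Qed.

(** Representatives of the 2-torsion points of the torus. Indexing by a finite type allows a
    distance bound uniform in [b]. *)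
Definition half_row (b : {ffun 'I_n -> bool}) : 'rV[R]_n :=
  \row_i (if b i then 2^-1 else 0).

(** A coordinate whose double is an integer is an integer or an integer plus one half; [b] marks the
    coordinates of the second kind. *)
Lemma half_row_decomp x : integral_row (x *+ 2) -> ~ integral_row x ->
  exists b, integral_row (x - half_row b) /\ ~ integral_row (half_row b).
Proof.
move=> x2 xN; pose b := [ffun i => x 0 i \isn't a Num.int].
have xb : integral_row (x - half_row b).
  move=> i; rewrite !mxE ffunE; case: ifPn => [xi|]; last first.
    by rewrite negbK subr0.
  have := x2 i; rewrite mulmxnE => x2i.
  have /andP[lo hi] := floor_itv (x 0 i).
  set f := Num.floor _ in lo hi.
  have /intrP[z zE] : x 0 i *+ 2 - f%:~R *+ 2 \is a Num.int.
    by rewrite rpredB// rpredMn// intr_int.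
  have zE' : z%:~R = (x 0 i - f%:~R) * 2 :> R by rewrite -zE mulrBl !mulr_natr.
  have z0 : (0 <= z)%R by rewrite -(ler0z R) zE' mulr_ge0// subr_ge0.
  have z2 : (z < 2)%R.
    rewrite -(ltr_int R) zE' -[ltRHS]mul1r ltr_pM2r//.
    by rewrite ltrBlDl -[X in _ + X]/(1%:~R) -intrD.
  (* The integer [z], twice the fractional part, is 0 or 1; the value 0 contradicts [xi]. *)
  case: z z0 z2 zE zE' => // -[|[|//]] _ _ zE zE'.
    exfalso; move: xi; suff -> : x 0 i = f%:~R by rewrite intr_int.
    move/eqP: zE'; rewrite mulr0z eq_sym mulf_eq0 pnatr_eq0 orbF subr_eq0.
    by move/eqP.
  suff -> : x 0 i - 2^-1 = f%:~R by rewrite intr_int.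
  move: zE' => /= zE'; have {}zE' : 1 = (x 0 i - f%:~R) * 2 by rewrite -zE'.
  by lra.
exists b; split=> // hb; apply: xN => i.
by have := rpredD (xb i) (hb i); rewrite !mxE subrK.
Qed.

(** Divide by the least power of 2 that destroys integrality. Its exponent is not 0, since [x] is
    integral, and the preceding power still gives an integral vector. *)
Lemma dyadic_fraction x : integral_row x -> x != 0 ->
  exists s : nat, let y := (2 ^+ s.+1)^-1 *: x in
    integral_row (y *+ 2) /\ ~ integral_row y.
Proof.
move=> ix x0.
pose P s : bool := `[< ~ integral_row ((2 ^+ s)^-1 *: x) >].
have exP : exists s, P s.
  have [i xi0] : exists i, x 0 i != 0.
    apply: contrapT => h; case/eqP: x0; apply/rowP => i; rewrite mxE.
    by apply/eqP/negPn/negP => xi; apply: h; exists i.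
  (* A nonzero coordinate divided by a power of 2 exceeding its absolute value lands strictly
     between -1 and 1 without vanishing, so it is not an integer. *)
  have [s xs] : exists s : nat, `|x 0 i| < 2 ^+ s.
    exists (Num.truncn `|x 0 i|).+1.
    apply: (lt_trans (truncnS_gt _)).
    by rewrite -natrX ltr_nat ltn_expl.
  exists s; apply/asboolP => /(_ i); rewrite mxE => /norm_intr_ge1.
  rewrite mulf_neq0 ?invr_neq0 ?expf_neq0 ?pnatr_eq0// => /(_ isT).
  have s0 : 0 < 2 ^+ s :> R by rewrite exprn_gt0.
  by rewrite normrM normfV (gtr0_norm s0) ler_pdivlMl// mulr1 leNgt xs.
case: (ex_minnP exP) => -[|s] /asboolP Ps mins.
  by case: Ps; rewrite expr0 invr1 scale1r.
exists s; split=> //.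
have : ~~ P s by apply/negP => /mins; rewrite ltnn.
move/asboolPn/contrapT; congr integral_row.
rewrite scalerMnl exprS; congr (_ *: _).
by rewrite -[RHS]mulr_natr invfM mulrAC mulVf ?mul1r// pnatr_eq0.
Qed.

Section ClosedSubgroup.
Variable L : set 'rV[R]_n.
Hypothesis L_closed : closed L.
Hypothesis LB : forall x y, L x -> L y -> L (x - y).
Hypothesis L_int : forall x, integral_row x -> L x.

Let L0 : L 0.
Proof. by apply: L_int => i; rewrite mxE rpred0. Qed.

Let LD x y : L x -> L y -> L (x + y).
Proof.
by move=> Lx Ly; rewrite -[y]opprK -[- y]sub0r; apply: LB => //; exact: LB.
Qed.

Let LMn x k : L x -> L (x *+ k).
Proof.
by move=> Lx; elim: k => [|k IH]; rewrite ?mulr0n// mulrS; exact: LD.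
Qed.

(* If L contains arbitrarily short vectors, a multiple of a short vector y is
   close to a nonzero integral vector m; dividing the multiple by a power of 2
   brings it close to a half-integral, non-integral vector. *)
Lemma half_row_in_subgroup :
  (forall e : R, 0 < e -> exists y, [/\ L y, y != 0 & `|y| < e]) ->
  exists b, L (half_row b) /\ ~ integral_row (half_row b).
Proof.
move=> small.
have close (e : R) : 0 < e -> exists z b,
    [/\ L z, ~ integral_row (half_row b) & `|z - half_row b| < e].
  (* Each of the two error terms below gets half of [e]; the bound 1 keeps the integral vector [m]
     away from 0. *)
  move=> e0; pose d := Num.min (e / 2) 1.
  have d0 : 0 < d by rewrite lt_min divr_gt0//= ltr01.
  have d1 : d <= 1 by rewrite ge_min lexx orbT.
  have de : d <= e / 2 by rewrite ge_min lexx.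
  have [y [Ly y0 yd]] := small _ d0.
  have ny0 : 0 < `|y| by rewrite normr_gt0.
  (* [B] copies of [y] have norm at least 1, hence so does any positive multiple of them, and an
     integral vector within [d] of such a multiple is nonzero. *)
  pose B := (Num.truncn `|y|^-1).+1.
  have By : 1 <= `|y *+ B|.
    rewrite normrMn -mulr_natr -ler_pdivrMl// mulr1 ltW//.
    exact: truncnS_gt.
  have [k [m [k0 im km]]] := simultaneous_approximation (y *+ B) d0.
  have m0 : m != 0.
    apply/eqP => mE; move: km; rewrite mE subr0 ltNge (le_trans d1)//.
    rewrite normrMn (le_trans By)// -mulr_natr ler_peMr ?ler1n//.
  have [s] := dyadic_fraction im m0; set h := _ *: m => /= -[h2 hN].
  have [b [hb bN]] := half_row_decomp h2 hN.
  (* [q] copies of [y] differ from [j] copies divided by [2 ^+ s.+1] by a fraction of [y], because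
     the remainder is smaller than the divisor. *)
  pose j := (B * k)%N; pose q := (j %/ 2 ^ s.+1)%N.
  exists (y *+ q - (h - half_row b)), b; split=> //.
    by apply: LB; [exact: LMn|exact: L_int].
  rewrite opprB addrA addrAC addrK.
  pose c : R := (2 ^+ s.+1)^-1.
  have c0 : 0 < c by rewrite invr_gt0 exprn_gt0.
  have c1 : c <= 1.
    by rewrite invf_le1 ?exprn_gt0// exprn_ege1// ler1n.
  have -> : y *+ q - h = c *: (y *+ B *+ k - m) - ((j %% 2 ^ s.+1)%:R * c) *: y.
    rewrite scalerBr -[c *: m]/h addrAC; congr (_ - _).
    rewrite -mulrnA -/j {1}(divn_eq j (2 ^ s.+1)) -/q mulrnDr scalerDr.
    rewrite -[y *+ (j %% _)]scaler_nat scalerA mulrC addrK.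
    by rewrite mulrnA -[y *+ q *+ _]scaler_nat scalerA natrX mulVf ?scale1r//.
  have mc : (j %% 2 ^ s.+1)%:R * c <= 1.
    rewrite ler_pdivrMr ?exprn_gt0// mul1r -natrX ler_nat ltnW// ltn_pmod//.
    by rewrite expn_gt0.
  rewrite (le_lt_trans (ler_normB _ _))// [e]splitr ltrD//.
    rewrite normrZ gtr0_norm//; apply: lt_le_trans de.
    by rewrite (le_lt_trans _ km)// ler_piMl.
  rewrite normrZ ger0_norm ?mulr_ge0 ?(ltW c0)//; apply: lt_le_trans de.
  by rewrite (le_lt_trans _ yd)// ler_piMl.
(* Otherwise the finitely many non-integral half rows all lie outside the closed set [L], at a
   common positive distance [e] from it, against [close]. *)
apply: contrapT => noL.
have : \forall e \near (0 : R)^'+, forall b : {ffun 'I_n -> bool},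
    ~ integral_row (half_row b) -> forall z, L z -> e <= `|z - half_row b|.
  apply: filter_forall => b.
  have [ib|ib] := pselect (integral_row (half_row b)).
    exact: nearW.
  have Lb : ~ L (half_row b) by move=> Lb; apply: noL; exists b.
  have /nbhs_ballP[d /= d0 dL] : nbhs (half_row b) (~` L).
    by apply: open_nbhs_nbhs; split=> //; exact: closed_openC.
  apply: filterS (nbhs_right_lt d0) => e ed _ z Lz; rewrite leNgt.
  apply/negP => ze; apply: (dL z) => //.
  by rewrite -ball_normE /= distrC (lt_trans ze).
move=> far; have [e [e0 {}far]] : exists e : R, 0 < e /\
    forall b : {ffun 'I_n -> bool}, ~ integral_row (half_row b) ->
    forall z, L z -> e <= `|z - half_row b|.
  near (0 : R)^'+ => e; exists e; split; first by near: e; exact: nbhs_right_gt.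
  by near: e.
have [z [b [Lz bN]]] := close _ e0.
by rewrite ltNge far.
Unshelve. all: by end_near. Qed.

(** [L] is the preimage of a closed subgroup of the torus. If a positive multiple of [x] is
    integral, [x] is itself rational. Otherwise its multiples come arbitrarily close to integral
    vectors without meeting them, and the differences are the short vectors of
    [half_row_in_subgroup]. Rational entries make the torsion elements to consider countable. *)
Lemma closed_subgroup_torsion x : L x -> ~ integral_row x ->
  exists r : 'rV[rat]_n,
    L (map_mx ratr r) /\ ~ integral_row (map_mx ratr r).
Proof.
move=> Lx xN.
have [[k [k0 ik]]|tf] :=
    pselect (exists k : nat, (0 < k)%N /\ integral_row (x *+ k)).
  pose r : 'rV[rat]_n := \row_i ((Num.floor ((x *+ k) 0 i))%:~R / k%:R).
  exists r; suff -> : map_mx ratr r = x by [].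
  apply/rowP => i; rewrite !mxE fmorph_div /= ratr_int ratr_nat.
  have := ik i; rewrite intrEfloor => /eqP ->.
  by rewrite mulmxnE -[x 0 i *+ k]mulr_natr mulfK// pnatr_eq0 -lt0n.
have [|b [Lb bN]] := half_row_in_subgroup; last first.
  exists (\row_i (if b i then 2^-1 else 0)).
  suff -> : map_mx ratr (\row_i (if b i then 2^-1 else 0)) = half_row b by [].
  apply/rowP => i; rewrite !mxE; case: ifP => _; rewrite ?rmorph0//.
  by rewrite fmorphV /= ratr_nat.
move=> e e0; have [k [m [k0 im km]]] := simultaneous_approximation x e0.
exists (x *+ k - m); split=> //; first by apply: LB; [exact: LMn|exact: L_int].
rewrite subr_eq0; apply/eqP => xm; apply: tf; exists k; split=> //.
by rewrite xm.
Qed.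

End ClosedSubgroup.

End TorusSubgroups.

(** * Periodic points of maps close to the identity *)

Section PeriodicMaps.
Variables (R : realType) (m : nat).
Notation V := 'rV[R]_m.

Lemma ball_convex (x0 x y : V) (d t : R) : ball x0 d x -> ball x0 d y ->
  0 <= t <= 1 -> ball x0 d (y + t *: (x - y)).
Proof.
rewrite -!ball_normE /= => bx by_ /andP[t0 t1].
have -> : x0 - (y + t *: (x - y)) = t *: (x0 - x) + (1 - t) *: (x0 - y).
  by apply/rowP => i; rewrite !mxE; ring.
have t1' : 0 <= 1 - t by rewrite subr_ge0.
rewrite (le_lt_trans (ler_normD _ _))// !normrZ !ger0_norm//.
have [->|tN0] := eqVneq t 0; first by rewrite mul0r add0r subr0 mul1r.
have -> : d = t * d + (1 - t) * d by ring.
by rewrite ltr_leD// ?ltr_pM2l ?ler_wpM2l// ?(ltW by_)// lt_def tN0.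
Qed.

(** Mean value inequality: the partial derivatives vanish at [x0], hence are small on a ball. The
    norm is the sup norm, so each coordinate of [r] is treated separately along a segment. *)
Lemma diff_small_lipschitz (W : set V) (r : V -> V) (x0 : V) (e : R) :
  open W -> W x0 -> 0 < e ->
  (forall x, W x -> differentiable r x) ->
  (forall v, {for x0, continuous ('D_v r)}) ->
  (forall v, 'D_v r x0 = 0) ->
  exists2 d : R, 0 < d & ball x0 d `<=` W /\
    forall x y, ball x0 d x -> ball x0 d y -> `|r x - r y| <= e * `|x - y|.
Proof.
move=> oW Wx0 e0 dr cr r0.
(* The increment is a sum over [m] partial derivatives; the divisor [m.+1] is never 0. *)
pose e' := e / m.+1%:R; have e'0 : 0 < e' by rewrite divr_gt0.
have : \forall x \near x0, W x /\ forall k, `|'D_(delta_mx 0 k) r x| < e'.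
  near=> x; split; first by near: x; exact: (open_nbhs_nbhs (conj oW Wx0)).
  near: x; apply: filter_forall => k.
  have /cvgrPdist_lt/(_ _ e'0) := cr (delta_mx 0 k).
  by rewrite r0; apply: filterS => x; rewrite sub0r normrN.
move=> /nbhs_ballP[d /= d0 dW]; exists d => //; split; first by move=> x /dW[].
move=> x y bx by_; apply: row_norm_le => [|i]; first by rewrite mulr_ge0// ltW.
pose c t : V := y + t *: (x - y).
pose g t : R := r (c t) 0 i.
pose dg t : R := ('d r (c t) (x - y)) 0 i.
have dgE t : 0 <= t <= 1 -> is_derive (t : R) 1 (g : R -> R) (dg t).
  move=> t01; have [Wc _] := dW _ (ball_convex bx by_ t01).
  have dc : is_diff (t : R) (c : R -> V) (fun s => s *: (x - y)).
    have := is_diffD (is_diff_cst y (t : R)) (is_diff_scalel (t : R) (x - y)).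
    by rewrite (_ : 0 + _ = (fun s => s *: (x - y)))// add0r.
  have [dc1 dc2] := dc; have dcr := differentiable_comp dc1 (dr _ Wc).
  have dcri : differentiable (g : R -> R) t.
    exact: (differentiable_comp dcr (differentiable_coord _ 0 i)).
  split; first exact/derivable1_diffP.
  have -> : dg t = 'D_1 ((r \o c) : R -> V) t 0 i.
    have dcE : 'd (c : R -> V) (t : R) 1 = x - y.
      by rewrite diff_val scale1r.
    rewrite deriveE// diff_comp//; last exact: dr.
    exact: (congr1 (fun v : V => ('d r (c t) v : V) 0 i) (esym dcE)).
  have /(congr1 (fun M : V => M 0 i)) :=
    @derive_mx R R 1 m (r \o c) t 1 (diff_derivable dcr).
  by rewrite mxE => ->.
have [||t t01] := @MVT_segment R g dg 0 1 ler01.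
- by move=> t; rewrite in_itv /= => /andP[t0 t1]; apply: dgE; rewrite !ltW.
- apply: derivable_within_continuous => t; rewrite in_itv /= => t01.
  by have [] := dgE _ t01.
rewrite subr0 mulr1 /g /c scale1r scale0r addr0 subrKC.
rewrite !mxE => ->.
have t01' : 0 <= t <= 1 by rewrite in_itv in t01.
have [Wt rt] := dW _ (ball_convex bx by_ t01').
rewrite /dg diff_row_sum; last exact: dr.
rewrite summxE (le_trans (ler_norm_sum _ _ _))//.
rewrite (@le_trans _ _ (\sum_(k < m) e' * `|x - y|))//.
  apply: ler_sum => k _; rewrite mxE normrM mulrC ler_pM//.
    by rewrite (le_trans (row_norm_ge _ _))// ltW// rt.
  exact: row_norm_ge.
rewrite sumr_const card_ord -mulrnAl ler_wpM2r// /e' -mulr_natr.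
by rewrite mulrAC ler_pdivrMr// ler_pM2l// ler_nat.
Unshelve. all: by end_near. Qed.

(** Along the orbit, each displacement [r (x j)] is within half of the norm of [r (x 0)] from
    [r (x 0)]. Over a closed orbit the displacements sum to 0, which forces [r (x 0)] to vanish. *)
Lemma periodic_fixed (h : V -> V) (B : set V) (k : nat) (x : nat -> V) :
  (0 < k)%N ->
  (forall y z, B y -> B z ->
    `|(h y - y) - (h z - z)| <= (2 ^+ k.+1)^-1 * `|y - z|) ->
  (forall j, (j <= k)%N -> B (x j)) ->
  (forall j, (j < k)%N -> x j.+1 = h (x j)) -> x k = x 0%N -> h (x 0%N) = x 0%N.
Proof.
move=> k0 hB Bx xS xk; set e := (_^-1) in hB.
pose r y := h y - y.
have ek : e * 2 ^+ k = 2^-1.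
  by rewrite /e exprS invfM -mulrA mulVf ?mulr1// expf_neq0.
have e0 : 0 < e by rewrite invr_gt0 exprn_gt0.
have e1 : e <= 1 by rewrite invf_le1 ?exprn_gt0// exprn_ege1// ler1n.
(* At each step the distance to the start at most doubles, plus one initial displacement. The
   constant [e] is chosen so that [e * 2 ^+ k] is one half. *)
have dist j : (j <= k)%N -> `|x j - x 0%N| <= (2 ^+ j - 1) * `|r (x 0%N)|.
  elim: j => [|j IH jk]; first by rewrite !subrr normr0 mul0r.
  have -> : x j.+1 - x 0%N =
      (x j - x 0%N) + r (x 0%N) + (r (x j) - r (x 0%N)).
    by rewrite xS// /r; apply/rowP => i; rewrite !mxE; ring.
  have h1 := hB _ _ (Bx _ (ltnW jk)) (Bx _ (leq0n k)).
  have h2 := IH (ltnW jk).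
  have h3 : e * `|x j - x 0%N| <= `|x j - x 0%N| by rewrite ler_piMl.
  rewrite (le_trans (ler_normD _ _))//.
  rewrite (le_trans (lerD (ler_normD _ _) (le_trans h1 h3)))//.
  rewrite exprS mulrBl mul1r -mulrA; move: h2; rewrite mulrBl mul1r.
  move: (2 ^+ j * `|r (x 0%N)|) (`|r (x 0%N)|) (`|x j - x 0%N|) => p a b; lra.
have : \sum_(j < k) r (x j) = 0.
  rewrite (eq_bigr (fun j : 'I_k => x j.+1 - x j)) => [|j _].
    rewrite -(big_mkord xpredT (fun j => x j.+1 - x j)).
    by rewrite telescope_sumr// xk subrr.
  by rewrite xS.
move=> sum0.
have kr : r (x 0%N) *+ k = \sum_(j < k) (r (x 0%N) - r (x j)).
  by rewrite sumrB sum0 subr0 sumr_const card_ord.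
have : `|r (x 0%N)| *+ k <= (2^-1 * `|r (x 0%N)|) *+ k.
  rewrite -normrMn kr (le_trans (ler_norm_sum _ _ _))//.
  rewrite -[k in leRHS]card_ord -sumr_const ler_sum// => j _.
  rewrite (le_trans (hB _ _ (Bx _ (leq0n k)) (Bx _ (ltnW (ltn_ord j)))))//.
  rewrite distrC -ek -mulrA ler_pM2l// (le_trans (dist _ (ltnW (ltn_ord j))))//.
  rewrite ler_wpM2r// lerBlDr (@le_trans _ _ (2 ^+ k))// ?lerDl//.
  by rewrite ler_eXn2l// ?ltr1n// ltnW.
rewrite lerMn2r -leqn0 leqNgt k0 /= => rle.
have : `|r (x 0%N)| = 0 by apply/eqP; rewrite eq_le normr_ge0 andbT; lra.
by move/normr0_eq0/eqP; rewrite subr_eq0 => /eqP.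
Qed.

End PeriodicMaps.

(** The completeness under which Baire's theorem applies to row vectors. *)
HB.instance Definition _ (R : realType) (m n : nat) :=
  Uniform_isComplete.Build 'M[R]_(m, n) cauchy_cvg.

Lemma closed_equalizer (S T : topologicalType) (f g : S -> T) :
  hausdorff_space T -> continuous f -> continuous g ->
  closed [set x | f x = g x].
Proof.
move=> hT cf cg x clx; apply: hT => A B fA gB.
have [y [/= fgy [fy gy]]] :
    [set x | f x = g x] `&` (f @^-1` A `&` g @^-1` B) !=set0.
  by apply: clx; apply: filterI; [exact: cf|exact: cg].
by exists (f y); split=> //; rewrite fgy.
Qed.

(** The displacement of [h] has zero derivative at [x0]; the resulting estimate is the one required
    by [periodic_fixed]. *)
Lemma near_identity_lipschitz (R : realType) (m : nat) (W : set 'rV[R]_m)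
    (h : 'rV[R]_m -> 'rV[R]_m) (x0 : 'rV[R]_m) (e : R) :
  open W -> W x0 -> 0 < e ->
  (forall x, W x -> differentiable h x) ->
  (forall v, {for x0, continuous ('D_v h)}) ->
  (forall v, 'D_v h x0 = v) ->
  exists2 d : R, 0 < d & ball x0 d `<=` W /\
    forall x y, ball x0 d x -> ball x0 d y ->
      `|(h x - x) - (h y - y)| <= e * `|x - y|.
Proof.
move=> oW Wx0 e0 dh ch h1; pose r x := h x - x.
have rE : r = h - id by apply/funext.
have dr x : W x -> differentiable r x.
  by move=> Wx; rewrite rE; apply: differentiableB => //; exact: dh.
have DrE v x : W x -> 'D_v r x = 'D_v h x - v.
  move=> Wx; rewrite rE deriveB//; first by rewrite derive_id.
  exact/diff_derivable/dh.
have cr v : {for x0, continuous ('D_v r)}.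
  have nE : {near x0, (fun x => 'D_v h x - v) =1 'D_v r}.
    have := @open_nbhs_nbhs _ _ _ (conj oW Wx0 : open_nbhs x0 W).
    by apply: filterS => x Wx; rewrite DrE.
  rewrite /prop_for /continuous_at -(nbhs_singleton nE).
  apply: cvg_trans; first exact: (near_eq_cvg nE).
  by apply: cvgB; [exact: ch|exact: cvg_cst].
have r0 v : 'D_v r x0 = 0 by rewrite DrE// h1 subrr.
exact: (diff_small_lipschitz oW Wx0 e0 dr cr r0).
Qed.

(** * Charts as local homeomorphisms *)

Section Charts.
Variables (R : realType) (n : nat) (T : topologicalType) (c : chart R n T).
Hypothesis cC : is_chart c.

Lemma chart_invK p : cdom c p -> cinv c (cmap c p) = p.
Proof. by case: cC => _ _ + _ _; exact. Qed.

Lemma chart_ccod p : cdom c p -> ccod c (cmap c p).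
Proof. by move=> cp; exists p. Qed.

Lemma chart_cdom x : ccod c x -> cdom c (cinv c x).
Proof. by move=> [p cp <-]; rewrite chart_invK. Qed.

Lemma chart_mapK x : ccod c x -> cmap c (cinv c x) = x.
Proof. by move=> [p cp <-]; rewrite chart_invK. Qed.

Lemma chart_cvg p : cdom c p -> cmap c q @[q --> p] --> cmap c p.
Proof. by case: cC => _ _ _ + _ => /[apply]. Qed.

Lemma chart_inv_cvg x : ccod c x -> cinv c y @[y --> x] --> cinv c x.
Proof. by case: cC => _ _ _ _ => /[apply]. Qed.

Lemma nbhs_cdom p : cdom c p -> nbhs p (cdom c).
Proof. by move=> cp; apply: open_nbhs_nbhs; split=> //; case: cC. Qed.

Lemma nbhs_ccod x : ccod c x -> nbhs x (ccod c).
Proof. by move=> cp; apply: open_nbhs_nbhs; split=> //; case: cC. Qed.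

Lemma open_chart_preimage A : open A -> open [set x | ccod c x /\ A (cinv c x)].
Proof.
move=> oA; have [_ oc _ _ ci] := cC.
have /(continuous_inP _ oc)/(_ _ oA) // : {in ccod c, continuous (cinv c)}.
by move=> x; rewrite inE => /ci.
Qed.

End Charts.

Section KahlerCharts.
Variables (R : realType) (n : nat) (N : kmanifold R n).
Hypothesis hN : is_kahler N.

Lemma atlas_is_chart (c : chart R n N) : atlas N c -> is_chart c.
Proof. exact: (kahler_atlas hN). Qed.

Lemma chart_atP (p : N) :
  [/\ atlas N (chart_at p), cdom (chart_at p) p & is_chart (chart_at p)].
Proof.
by have [ac cp] := kahler_chart_at hN p; split=> //; exact: atlas_is_chart.
Qed.

End KahlerCharts.

(** * Fixed points of torus elements and density of the free points *)

Lemma tclass_eqP (R : realType) n (s t : 'rV[R]_n) :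
  tclass s = tclass t <-> integral_row (s - t).
Proof.
split; first by move=> /eqmodP/forallP.
by move=> st; apply/eqmodP/forallP.
Qed.

Section FreePoints.
Variables (R : realType) (n : nat) (N : kmanifold R n).
Variable Phi : torus R n -> N -> N.
Hypothesis hN : kahler_toric Phi.

Let Phi0 p : Phi (tclass 0) p = p.
Proof. exact: (action0 (toric_action hN)). Qed.

Let PhiD s t p : Phi (tclass (s + t)) p = Phi (tclass s) (Phi (tclass t) p).
Proof. exact: (actionD (toric_action hN)). Qed.

Lemma toric_continuous a : continuous (Phi a).
Proof.
by have [[cPhi _] _ _ _] := toric_isometric hN a; move=> p; exact: cPhi.
Qed.

Let kN := toric_kahler hN.

Let fixed a : set N := [set p | Phi a p = p].

Let closed_fixed a : closed (fixed a).
Proof.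
apply: closed_equalizer; first exact: (kahler_hausdorff kN).
  exact: toric_continuous.
by move=> p; exact: cvg_id.
Qed.

(* A torsion element fixing an open set accumulating at p has identity
   differential at p; being of finite order, it is the identity near p. *)
Let closed_interior_fixed t k : (0 < k)%N -> integral_row (t *+ k) ->
  closed (interior (fixed (tclass t))).
Proof.
move=> k0 tk p clp; set a := tclass t.
have fp : fixed a p.
  apply: closed_fixed; move: clp; apply: closure_subset; exact: interior_subset.
have [ac cp cC] := chart_atP kN p; set c := chart_at p in ac cp cC.
pose h := cmap c \o Phi a \o cinv c.
pose W := [set x | ccod c x /\ cdom c (Phi a (cinv c x))].
have oW : open W.
  apply: (@open_chart_preimage _ _ _ c cC (Phi a @^-1` cdom c)).
  have [oc _ _ _ _] := cC.
  by move/continuousP: (@toric_continuous a); exact.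
have smh : smooth_on W h.
  have [[_ /(_ c c ac ac) sm] _ _ _] := toric_isometric hN a.
  by move=> vs x [Wx1 Wx2]; exact: sm.
have Wx0 : W (cmap c p).
  by split; [exact: chart_ccod|rewrite chart_invK// fp].
have ch v : {for cmap c p, continuous ('D_v h)}.
  by apply: differentiable_continuous; exact: (smh [:: v]).
(* If the derivative differed from [v] at [p], it would do so near [p] by continuity; but interior
   fixed points accumulate at [p], and around them [h] is the identity. *)
have h1 v : 'D_v h (cmap c p) = v.
  apply: contrapT => /eqP hv.
  have : \forall x \near cmap c p, 'D_v h x != v.
    have := ch v; rewrite /prop_for /continuous_at => /cvgrPdist_lt.
    move=> /(_ `|'D_v h (cmap c p) - v|); rewrite normr_gt0 subr_eq0 => /(_ hv).
    apply: filterS => x hx; apply/eqP => xv; move: hx.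
    by rewrite xv ltxx.
  move=> /(chart_cvg cC cp) hq.
  have {}hq : nbhs p [set q | 'D_v h (cmap c q) != v] := hq.
  have [q [iq [hq1 cq]]] := clp _ (filterI hq (nbhs_cdom cC cp)).
  move: hq1; rewrite /= => /negP; apply; apply/eqP.
  rewrite -[RHS](derive_id (cmap c q)); apply: near_eq_derive.
  have ccq : ccod c (cmap c q) by exact: chart_ccod.
  have : \forall x \near cmap c q, fixed a (cinv c x).
    by apply: (chart_inv_cvg cC ccq); rewrite /= chart_invK.
  move: (nbhs_ccod cC ccq); apply: filterS2 => x ccx fx.
  by rewrite /h /= fx chart_mapK.
have e0 : 0 < (2 ^+ k.+1)^-1 :> R by rewrite invr_gt0 exprn_gt0.
have [d d0 [dW lip]] := @near_identity_lipschitz _ _ W h (cmap c p) _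
  oW Wx0 e0 (fun x Wx => smh [::] x Wx) ch h1.
pose U q := cdom c q /\ ball (cmap c p) d (cmap c q).
have Up : nbhs p U.
  apply: filterI; first exact: nbhs_cdom.
  by apply: (chart_cvg cC cp); exact: nbhsx_ballx.
have fpj j : Phi (tclass (t *+ j)) p = p.
  by elim: j => [|j IH]; rewrite ?mulr0n// mulrS PhiD IH.
(* Every multiple of [t] fixes [p], so near [p] the orbit stays in [U] up to the index [k] included,
   where it closes. *)
have : \forall q \near p, forall j : 'I_k.+1, U (Phi (tclass (t *+ j)) q).
  apply: filter_forall => j; apply: (@toric_continuous (tclass (t *+ j)) p).
  by rewrite /= fpj.
apply: filterS => q Uq; rewrite /fixed /=.
have Uq' j : (j <= k)%N -> U (Phi (tclass (t *+ j)) q).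
  by move=> jk; exact: (Uq (Ordinal (jk : (j < k.+1)%N))).
pose x j := cmap c (Phi (tclass (t *+ j)) q).
have xS j : (j < k)%N -> x j.+1 = h (x j).
  move=> jk; have [cj _] := Uq' _ (ltnW jk).
  by rewrite /h /x /= (chart_invK cC cj) mulrS PhiD.
have hx : h (x 0%N) = x 0%N.
  have Bx j : (j <= k)%N -> ball (cmap c p) d (x j) by case/Uq'.
  apply: (periodic_fixed k0 lip Bx xS).
  rewrite /x mulr0n; congr (cmap c (Phi _ q)).
  by apply/tclass_eqP; rewrite subr0.
have [cq _] := Uq' 0%N (leq0n _); have [cq1 _] := Uq' 1%N k0.
rewrite mulr0n Phi0 in cq; rewrite mulr1n in cq1.
move: hx; rewrite /h /x /= mulr0n Phi0 chart_invK// => /(congr1 (cinv c)).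
by rewrite !chart_invK.
Qed.

(** The interior is open, closed and nonempty in a connected space, so the element acts
    trivially. *)
Lemma interior_fixed_torsion t k : (0 < k)%N -> integral_row (t *+ k) ->
  interior (fixed (tclass t)) !=set0 -> tclass t = tclass 0.
Proof.
move=> k0 tk ne; apply: (toric_effective hN) => p.
have : interior (fixed (tclass t)) = setT.
  apply: (toric_connected hN) => //.
    exists (interior (fixed (tclass t))); rewrite ?setTI//.
    exact: open_interior.
  exists (interior (fixed (tclass t))); rewrite ?setTI//.
  exact: closed_interior_fixed tk.
move=> E; have : interior (fixed (tclass t)) p by rewrite E.
exact: interior_subset.
Qed.

Let rtors (r : 'rV[rat]_n) : 'rV[R]_n := map_mx ratr r.

Let rtors_torsion r : exists2 k : nat, (0 < k)%N & integral_row (rtors r *+ k).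
Proof.
exists (\prod_(i < n) `|denq (r 0%R i)|%N)%N.
  by rewrite prodn_gt0// => i; rewrite absz_gt0 denq_neq0.
move=> i; rewrite mulmxnE mxE (bigD1 i)//= mulrnA rpredMn//.
rewrite -[ratr _ *+ _]mulr_natr -(ratr_nat R) -rmorphM /=.
have -> : r 0 i * `|denq (r 0%R i)|%N%:R = (numq (r 0 i))%:~R.
  by rewrite natr_absz ger0_norm ?denq_ge0// numqE.
by rewrite ratr_int intr_int.
Qed.

(** The stabiliser of [p], lifted to row vectors, is a closed subgroup containing the integral rows,
    so [closed_subgroup_torsion] applies. *)
Lemma nonfree_torsion p : ~ free_points Phi p ->
  exists r : 'rV[rat]_n,
    tclass (rtors r) <> tclass 0 /\ Phi (tclass (rtors r)) p = p.
Proof.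
move=> nf; pose L := [set t : 'rV[R]_n | Phi (tclass t) p = p].
have [t [Lt t0]] : exists t, L t /\ ~ integral_row t.
  apply: contrapT => h; apply: nf => a; rewrite -[a]reprK => ap.
  apply: contrapT => a0; apply: h; exists (repr a); split=> // ia.
  by apply: a0; apply/tclass_eqP; rewrite subr0.
have [||| r [Lr rN]] := @closed_subgroup_torsion _ _ L _ _ _ t Lt t0.
- apply: (@closed_equalizer _ _ (fun t => Phi (tclass t) p) (cst p)).
  + exact: (kahler_hausdorff kN).
  + move=> s; apply: (@continuous_comp _ _ _ (fun s : 'rV[R]_n => (s, p))
      (fun z : 'rV[R]_n * N => Phi (tclass z.1) z.2) s).
      move=> A [[B C] /= [Bs Cp] BC].
      apply: filterS (Bs : nbhs s B) => y By; apply: BC; split=> //=.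
      exact: nbhs_singleton.
    exact: (action_continuous (toric_action hN)).
  + exact: cst_continuous.
- move=> x y Lx Ly; rewrite /L /= -[in LHS]Ly -PhiD subrK; exact: Lx.
- move=> x ix; rewrite /L /=; suff -> : tclass x = tclass 0 by [].
  by apply/tclass_eqP; rewrite subr0.
exists r; split=> // /tclass_eqP; rewrite subr0; exact: rN.
Qed.

(** Baire's theorem is applied in the model space, through a chart that meets the given open set. *)
Lemma dense_free_points : dense (free_points Phi).
Proof.
move=> O [p Op] oO; have [ac cp cC] := chart_atP kN p.
set c := chart_at p in ac cp cC.
pose moved r := [set x | ccod c x /\ ~ fixed (tclass (rtors r)) (cinv c x)].
(* Indices that code no rational row, or a row trivial in the torus, contribute the whole space.
   Adding the exterior of [ccod c] makes each set dense in the whole model space. *)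
pose F (i : nat) : set (Cn R n) :=
  if (unpickle i : option 'rV[rat]_n) is Some r then
    if `[< tclass (rtors r) = tclass 0 >] then setT
    else moved r `|` ~` closure (ccod c)
  else setT.
have openF i : open (F i) /\ dense (F i).
  rewrite /F; case: unpickle => [r|]; last first.
    by split; [exact: openT|move=> B [x Bx] _; exists x].
  case: asboolP => [_|r0].
    by split; [exact: openT|move=> B [x Bx] _; exists x].
  split.
    apply: openU; last by apply: closed_openC; exact: closed_closure.
    apply: (@open_chart_preimage _ _ _ c cC (~` fixed (tclass (rtors r)))).
    by apply: closed_openC; exact: closed_fixed.
  move=> B [x Bx] oB.
  have [[y [cy By]]|Bc] := pselect (ccod c `&` B !=set0); last first.
    exists x; split=> //; right=> /(_ B) []; first exact: open_nbhs_nbhs.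
    by move=> y yB; apply: Bc; exists y.
  (* If [B] missed the set, the torsion element would fix an open set of points. *)
  apply: contrapT => Bfix; apply: r0.
  have [k k0 rk] := rtors_torsion r.
  apply: (interior_fixed_torsion k0 rk); exists (cinv c y).
  have cdy := chart_cdom cC cy.
  have : \forall q \near cinv c y, cdom c q /\ B (cmap c q).
    apply: filterI; first exact: nbhs_cdom.
    apply: (chart_cvg cC cdy); rewrite /= chart_mapK//.
    exact: open_nbhs_nbhs.
  apply: filterS => q [cq Bq]; apply: contrapT => nfq; apply: Bfix.
  exists (cmap c q); split=> //; left; split; first exact: chart_ccod.
  by rewrite chart_invK.
have [||x [[cx Ox] Fx]] := @Baire R 'rV[R]_(n + n) F openF
  [set x | ccod c x /\ O (cinv c x)].
- by exists (cmap c p); split; [exact: chart_ccod|rewrite chart_invK].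
- exact: open_chart_preimage.
exists (cinv c x); split=> //; apply: contrapT => /nonfree_torsion[r [r0 fr]].
have := Fx (pickle r) I; rewrite /F pickleK; case: asboolP => // _ [[_]|].
  by apply.
by apply; exact: subset_closure.
Qed.

End FreePoints.

(** * Chain rule for germs, and limits of matrix expressions *)

Section ChainRule.
Variables (R : numFieldType) (U V W : normedModType R).

(** Composites of chart expressions agree with the intended map only near the point, which is why
    [k] is a separate map. *)
Lemma diff_comp_near (f : U -> V) (g : V -> W) (k : U -> W) (x : U) :
  differentiable f x -> differentiable g (f x) ->
  (\near x, g (f x) = k x) ->
  differentiable k x /\ forall u, 'd k x u = 'd g (f x) ('d f x u).
Proof.
move=> df dg gf; have dgf := differentiable_comp df dg.
have [dk kE] := near_eq_diff gf dgf; split=> // u.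
by rewrite kE diff_comp.
Qed.

End ChainRule.

Lemma diff_comp3_near (R : numFieldType) (U V W Z : normedModType R)
    (f : U -> V) (g : V -> W) (h : W -> Z) (k : U -> Z)
    (x : U) (y : V) (z : W) :
  f x = y -> g y = z ->
  differentiable f x -> differentiable g y -> differentiable h z ->
  (\near x, h (g (f x)) = k x) ->
  forall u, 'd h z ('d g y ('d f x u)) = 'd k x u.
Proof.
move=> fx gy; rewrite -gy -fx => df dg dh hgf u.
have dgf := differentiable_comp df dg.
have [_ ->] := diff_comp_near dgf dh hgf.
by rewrite (diff_comp df dg).
Qed.

Lemma diff_comp_id (R : numFieldType) (V W : normedModType R) (f : V -> W)
    (g : W -> V) (x u : V) :
  differentiable f x -> differentiable g (f x) -> (\near x, g (f x) = x) ->
  'd g (f x) ('d f x u) = u.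
Proof.
move=> df dg gf; have [_ /(_ u) <-] := diff_comp_near df dg gf.
by rewrite diff_val.
Qed.

Section MatrixLimits.
Variables (R : realType) (T : Type) (F : set_system T).
Hypothesis FF : Filter F.

Lemma cvg_big_sum (I : Type) (r : seq I) (P : pred I) (f : I -> T -> R)
    (l : I -> R) :
  (forall i, f i @ F --> l i) ->
  (\sum_(i <- r | P i) f i x) @[x --> F] --> \sum_(i <- r | P i) l i.
Proof.
move=> fl; elim: r => [|i r IH].
  under eq_fun do rewrite big_nil.
  by rewrite big_nil; exact: cvg_cst.
under eq_fun do rewrite big_cons.
by rewrite big_cons; case: (P i) => //; apply: cvgD; [exact: fl|exact: IH].
Qed.

Lemma cvg_big_prod (I : Type) (r : seq I) (P : pred I) (f : I -> T -> R)
    (l : I -> R) :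
  (forall i, f i @ F --> l i) ->
  (\prod_(i <- r | P i) f i x) @[x --> F] --> \prod_(i <- r | P i) l i.
Proof.
move=> fl; elim: r => [|i r IH].
  under eq_fun do rewrite big_nil.
  by rewrite big_nil; exact: cvg_cst.
under eq_fun do rewrite big_cons.
by rewrite big_cons; case: (P i) => //; apply: cvgM; [exact: fl|exact: IH].
Qed.

Lemma cvg_det (m : nat) (A : T -> 'M[R]_m) (B : 'M[R]_m) :
  (forall i j, (A x i j) @[x --> F] --> B i j) ->
  (\det (A x)) @[x --> F] --> \det B.
Proof.
move=> AB; rewrite /determinant; apply: cvg_big_sum => s.
by apply: cvgM; [exact: cvg_cst|apply: cvg_big_prod => i; exact: AB].
Qed.

(** By Cramer's rule the inverse is the adjugate over the determinant, so the form is a quotient of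
    polynomials in the entries, with nonzero denominator at the limit. *)
Lemma cvg_invmx_form (m : nat) (A : T -> 'M[R]_m) (B : 'M[R]_m)
    (D : T -> 'rV[R]_m) (E : 'rV[R]_m) :
  (forall i j, (A x i j) @[x --> F] --> B i j) ->
  (forall i, (D x 0 i) @[x --> F] --> E 0 i) ->
  B \in unitmx -> (\near F, A F \in unitmx) ->
  ((D x *m invmx (A x) *m (D x)^T) 0 0) @[x --> F] -->
  (E *m invmx B *m E^T) 0 0.
Proof.
move=> AB DE uB uA.
have formE (M : 'M[R]_m) (v : 'rV[R]_m) : M \in unitmx ->
    (v *m invmx M *m v^T) 0 0 =
    (\det M)^-1 * \sum_j (\sum_i v 0 i * \adj M i j) * v 0 j.
  move=> uM; rewrite mxE mulr_sumr; apply: eq_bigr => j _.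
  rewrite !mxE mulrA mulr_sumr; congr (_ * _); apply: eq_bigr => i _.
  by rewrite /invmx uM mxE mulrCA.
rewrite (formE B)//; apply: cvg_trans.
  apply: (@near_eq_cvg _ _ F _ (fun x => (\det (A x))^-1 *
      \sum_j (\sum_i D x 0 i * \adj (A x) i j) * D x 0 j)).
  by move: uA; apply: filterS => x uA; rewrite formE.
apply: cvgM.
  apply: cvgV; last exact: cvg_det.
  by move: uB; rewrite unitmxE unitfE.
apply: cvg_big_sum => j; apply: cvgM; last exact: DE.
apply: cvg_big_sum => i; apply: cvgM; first exact: DE.
under eq_fun do rewrite mxE /cofactor; rewrite mxE /cofactor.
apply: cvgM; first exact: cvg_cst.
by apply: cvg_det => a b; under eq_fun do rewrite !mxE; rewrite !mxE; exact: AB.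
Qed.

End MatrixLimits.

(** * The gradient on a Kähler manifold, computed in a fixed chart *)

Section KahlerMetric.
Variables (R : realType) (n : nat) (N : kmanifold R n).
Hypothesis hN : is_kahler N.

Lemma metricDl (p : N) u v w : metric p (u + v) w = metric p u w + metric p v w.
Proof. by rewrite /metric !mulmxDl mxE. Qed.

Lemma metricNl (p : N) u w : metric p (- u) w = - metric p u w.
Proof. by rewrite /metric !mulNmx mxE. Qed.

Lemma metric_eq0 (p : N) u : metric p u u = 0 -> u = 0.
Proof.
move=> u0; apply/eqP; apply: contraT => /(kahler_pos hN p).
by rewrite u0 ltxx.
Qed.

(** [grad] is chosen by [xget]: the vector [w] shows that the set is nonempty, and positive
    definiteness makes it a singleton. *)
Lemma grad_unique f (p : N) w :
  (forall u, metric p w u = dfun f p u) -> grad f p = w.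
Proof.
move=> wE; have gE : forall u, metric p (grad f p) u = dfun f p u.
  by apply: (xgetI 0 (P := [set w | forall u, metric p w u = dfun f p u]) wE).
apply/eqP; rewrite -subr_eq0; apply/eqP/(@metric_eq0 p).
by rewrite metricDl metricNl gE wE subrr.
Qed.

Section Transition.
Variables (c c' : chart R n N) (q : N).
Hypotheses (ac : atlas N c) (ac' : atlas N c').
Hypotheses (cq : cdom c q) (cq' : cdom c' q).

Lemma near_chart_inv (A : set N) : nbhs q A ->
  \forall x \near cmap c q, ccod c x /\ A (cinv c x).
Proof.
move=> qA; have cC := atlas_is_chart hN ac.
have ccq := @chart_ccod _ _ _ c _ cq.
apply: filterI; first exact: nbhs_ccod.
by apply: (chart_inv_cvg cC ccq); rewrite /= chart_invK.
Qed.

Lemma transition_differentiable :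
  differentiable (cmap c' \o cinv c) (cmap c q).
Proof.
have [sm _] := kahler_transition hN ac ac'.
apply: (sm [::]); split; first exact: chart_ccod.
by rewrite chart_invK//; exact: (atlas_is_chart hN).
Qed.

Lemma near_transitionK : \forall x \near cmap c q,
  cinv c' ((cmap c' \o cinv c) x) = cinv c x /\ ccod c x.
Proof.
have cC' := atlas_is_chart hN ac'.
move: (near_chart_inv (nbhs_cdom cC' cq')); apply: filterS => x [ccx cx'].
by rewrite /= chart_invK.
Qed.

Lemma transition_point : (cmap c' \o cinv c) (cmap c q) = cmap c' q.
Proof. by rewrite /= chart_invK//; exact: (atlas_is_chart hN). Qed.

End Transition.

Lemma diff_transitionK (c c' : chart R n N) (q : N) u :
  atlas N c -> atlas N c' -> cdom c q -> cdom c' q ->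
  'd (cmap c \o cinv c') (cmap c' q) ('d (cmap c' \o cinv c) (cmap c q) u) = u.
Proof.
move=> ac ac' cq cq'; rewrite -(transition_point c' ac cq).
apply: diff_comp_id; first exact: transition_differentiable.
  by rewrite transition_point//; exact: transition_differentiable.
move: (near_transitionK ac ac' cq cq'); apply: filterS => x [E ccx].
by rewrite [LHS]/= E chart_mapK//; exact: (atlas_is_chart hN).
Qed.

Variable f : N -> R.
Hypothesis smf : smooth_fun f.

Lemma dfun_transition (c : chart R n N) (q : N) u : atlas N c -> cdom c q ->
  dfun f q ('d (cmap (chart_at q) \o cinv c) (cmap c q) u) =
  'd (f \o cinv c : Cn R n -> R^o) (cmap c q) u.
Proof.
move=> ac cq; have [ac' cq' cC'] := chart_atP hN q.
rewrite /dfun /coord_at -(transition_point (chart_at q) ac cq).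
apply/esym; apply: (diff_comp_near _ _ _).2.
- exact: transition_differentiable.
- rewrite transition_point//.
  by apply: (smf ac' [::]); exact: chart_ccod.
- move: (near_transitionK ac ac' cq cq'); apply: filterS => x [E ccx].
  by rewrite [LHS]/= E.
Qed.

(** [gram q] refers to the chart [chart_at q], which may jump with [q]. Continuity is therefore read
    off the matrix of the metric in one chart [c]. *)
Definition chart_gram (c : chart R n N) (x : Cn R n) : 'M[R]_(n + n) :=
  \matrix_(i, j) in_chart (@metric R n N) c x (delta_mx 0 i) (delta_mx 0 j).

Definition chart_dfun (c : chart R n N) (x : Cn R n) : Cn R n :=
  \row_i 'D_(delta_mx 0 i) (f \o cinv c : Cn R n -> R^o) x.

Section InChart.
Variables (c : chart R n N) (q : N).
Hypotheses (ac : atlas N c) (cq : cdom c q).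

Let T := 'd (cmap (chart_at q) \o cinv c) (cmap c q).
Let T' := 'd (cmap c \o cinv (chart_at q)) (coord_at q).

Let TK u : T' (T u) = u.
Proof. by have [? ? _] := chart_atP hN q; exact: diff_transitionK. Qed.

Let T'K u : T (T' u) = u.
Proof. by have [? ? _] := chart_atP hN q; exact: diff_transitionK. Qed.

Let gramE u v :
  metric q (T u) (T v) = (u *m chart_gram c (cmap c q) *m v^T) 0 0.
Proof.
have cC := atlas_is_chart hN ac.
have -> : chart_gram c (cmap c q) = lin1_mx T *m gram q *m (lin1_mx T)^T.
  apply/matrixP => i j; rewrite mxE /in_chart chart_invK// /metric.
  rewrite -!mul_rV_lin1 trmx_mul !mulmxA trmx_delta -colE mxE.
  by rewrite -!mulmxA -rowE mxE.
by rewrite /metric -!mul_rV_lin1 trmx_mul !mulmxA.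
Qed.

Lemma chart_gram_unit : chart_gram c (cmap c q) \in unitmx.
Proof.
rewrite -row_free_unit; apply: inj_row_free => u uG.
have Tu : T u = 0 by apply: (@metric_eq0 q); rewrite gramE uG mul0mx mxE.
exact: etrans (esym (TK u)) (etrans (congr1 T' Tu) (linear0 T')).
Qed.

(** The squared norm of the gradient is the inverse metric evaluated on the differential, an
    expression whose ingredients vary continuously in the fixed chart. *)
Lemma grad_norm_chart : metric q (grad f q) (grad f q) =
  (chart_dfun c (cmap c q) *m invmx (chart_gram c (cmap c q)) *m
   (chart_dfun c (cmap c q))^T) 0 0.
Proof.
set G := chart_gram _ _; set D := chart_dfun _ _.
have dfE u : dfun f q (T u) = (D *m u^T) 0 0.
  rewrite dfun_transition// diff_row_sum; last first.
    by apply: (smf ac [::]); exact: chart_ccod.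
  by rewrite mxE; apply: eq_bigr => i _; rewrite !mxE mulrC.
(* [D *m invmx G] is the gradient in the chart [c]; [T] carries it to the preferred chart at [q]. *)
have -> : grad f q = T (D *m invmx G).
  apply: grad_unique => u; rewrite -[u]T'K gramE dfE -/G mulmxKV//.
  exact: chart_gram_unit.
rewrite gramE -/G mulmxKV; last exact: chart_gram_unit.
have -> : D *m (D *m invmx G)^T = (D *m invmx G *m D^T)^T.
  by rewrite [RHS]trmx_mul trmxK.
by rewrite mxE.
Qed.

End InChart.

Lemma cvg_chart_gram (c : chart R n N) (p : N) i j : atlas N c -> cdom c p ->
  (chart_gram c (cmap c q) i j) @[q --> p] --> chart_gram c (cmap c p) i j.
Proof.
move=> ac cp; have cC := atlas_is_chart hN ac.
pose g x : R^o := in_chart (@metric R n N) c x (delta_mx 0 i) (delta_mx 0 j).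
have gE x : chart_gram c x i j = g x by rewrite /chart_gram mxE.
have E : (fun q => chart_gram c (cmap c q) i j) = g \o cmap c.
  by apply/funext => q; exact: gE.
have : (g \o cmap c) q @[q --> p] --> g (cmap c p).
  apply: (cvg_comp _ _ (chart_cvg cC cp)); apply: differentiable_continuous.
  apply: (kahler_smooth hN (delta_mx 0 i) (delta_mx 0 j) ac [::]).
  exact: chart_ccod.
by rewrite -E -gE.
Qed.

Lemma cvg_chart_dfun (c : chart R n N) (p : N) i : atlas N c -> cdom c p ->
  (chart_dfun c (cmap c q) 0 i) @[q --> p] --> chart_dfun c (cmap c p) 0 i.
Proof.
move=> ac cp; have cC := atlas_is_chart hN ac.
pose g := 'D_(delta_mx 0 i) (f \o cinv c : Cn R n -> R^o).
have gE x : chart_dfun c x 0 i = g x by rewrite /chart_dfun mxE.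
have E : (fun q => chart_dfun c (cmap c q) 0 i) = g \o cmap c.
  by apply/funext => q; exact: gE.
have : (g \o cmap c) q @[q --> p] --> g (cmap c p).
  apply: (cvg_comp _ _ (chart_cvg cC cp)); apply: differentiable_continuous.
  apply: (smf ac [:: delta_mx 0 i]); exact: chart_ccod.
by rewrite -E -gE.
Qed.

Lemma continuous_grad_norm :
  continuous (fun q : N => metric q (grad f q) (grad f q)).
Proof.
move=> p; have [ac cp cC] := chart_atP hN p; set c := chart_at p in ac cp cC.
rewrite /continuous_at (grad_norm_chart ac cp).
apply: cvg_trans.
  apply: (@near_eq_cvg _ _ (nbhs p) _ (fun q => (chart_dfun c (cmap c q) *m
    invmx (chart_gram c (cmap c q)) *m (chart_dfun c (cmap c q))^T) 0 0)).
  move: (nbhs_cdom cC cp); apply: filterS => q cq.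
  by rewrite (grad_norm_chart ac cq).
have ccp := chart_ccod cp.
apply: (@cvg_invmx_form R N (nbhs p) (nbhs_filter p) _
  (fun q => chart_gram c (cmap c q)) _ (fun q => chart_dfun c (cmap c q))).
- by move=> i j; exact: cvg_chart_gram.
- by move=> i; exact: cvg_chart_dfun.
- exact: chart_gram_unit.
- by move: (nbhs_cdom cC cp); apply: filterS => q cq; exact: chart_gram_unit.
Qed.

End KahlerMetric.

(** * Transport of gradients along isometries *)

Section Pullback.
Variables (R : realType) (n : nat) (N : kmanifold R n).
Hypothesis hN : is_kahler N.

(** [L] pulls the metric back to the definite form [m], so it is injective and thus invertible; it
    then carries [w], the gradient with respect to [m], to the gradient of [f]. *)
Lemma grad_norm_pullback (f : N -> R) (p : N)
    (L : {linear Cn R n -> Cn R n}) (m : 'M[R]_(n + n)) (w : Cn R n) :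
  (forall u v : Cn R n, metric p (L u) (L v) = (u *m m *m v^T) 0 0) ->
  (forall u : Cn R n, (u *m m *m u^T) 0 0 = 0 -> u = 0) ->
  (forall u : Cn R n, dfun f p (L u) = (w *m m *m u^T) 0 0) ->
  metric p (grad f p) (grad f p) = (w *m m *m w^T) 0 0.
Proof.
move=> Sm m0 fS.
have uS : lin1_mx L \in unitmx.
  rewrite -row_free_unit; apply: inj_row_free => u; rewrite mul_rV_lin1 => Su.
  by apply: m0; rewrite -Sm Su /metric !mul0mx mxE.
suff -> : grad f p = L w by rewrite Sm.
apply: (grad_unique hN) => u.
have -> : u = L (u *m invmx (lin1_mx L)) by rewrite -mul_rV_lin1 mulmxKV.
by rewrite Sm fS.
Qed.

Section InverseIsometry.
Variables (phi phi' : N -> N).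
Hypotheses (sphi : smooth_map_on setT phi) (sphi' : smooth_map_on setT phi').
Hypotheses (phiK : cancel phi phi') (phi'K : cancel phi' phi).
Hypothesis phi_isometry : forall p u v,
  metric (phi p) (tangent_map phi p u) (tangent_map phi p v) = metric p u v.

(** The differential of [B] is a right inverse of the isometry [tangent_map phi p]. The target chart
    of [B] is [chart_at p], where a tangent map of [phi'] would have [chart_at (phi' (phi p))]. *)
Lemma inverse_isometry (p : N) :
  let B := cmap (chart_at p) \o phi' \o cinv (chart_at (phi p)) in
  differentiable B (coord_at (phi p)) /\
  forall u v, metric p ('d B (coord_at (phi p)) u) ('d B (coord_at (phi p)) v) =
              metric (phi p) u v.
Proof.
move=> B; have [ac cp cC] := chart_atP hN p.
have [ac' cp' cC'] := chart_atP hN (phi p).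
pose C := cmap (chart_at (phi p)) \o phi \o cinv (chart_at p).
have Bp : B (coord_at (phi p)) = coord_at p.
  by rewrite /B /coord_at /= chart_invK// phiK.
have dB : differentiable B (coord_at (phi p)).
  apply: (sphi'.2 _ _ ac' ac [::]); split=> //; first exact: chart_ccod.
  by rewrite chart_invK// phiK.
have dC : differentiable C (B (coord_at (phi p))).
  rewrite Bp; apply: (sphi.2 _ _ ac ac' [::]); split=> //.
    exact: chart_ccod.
  by rewrite chart_invK.
split=> // u v.
have CB : \forall x \near coord_at (phi p), C (B x) = x.
  have : nbhs (phi p) (phi' @^-1` cdom (chart_at p)).
    apply: (sphi'.1 (phi p) I); rewrite /= phiK; exact: nbhs_cdom.
  move=> /(near_chart_inv hN ac' cp'); apply: filterS => x [ccx cx].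
  by rewrite /C /B /= chart_invK// phi'K chart_mapK.
have CK w : tangent_map phi p ('d B (coord_at (phi p)) w) = w.
  by rewrite /tangent_map -Bp; exact: diff_comp_id.
by rewrite -phi_isometry !CK.
Qed.

End InverseIsometry.
End Pullback.

(** * The variance identity over the free points, through the torification *)

Section Torification.
Variables (R : realType) (n : nat) (Omega : finType) (E : exp_family R n Omega).

Lemma quotient_metricE (Y : 'rV[R]_n -> 'M[R]_n)
    (e : quotient_kmanifold E Y) u v :
  metric e u v =
  (lsubmx u *m fisher E (piL e) *m (lsubmx v)^T) 0 0 +
  (rsubmx u *m fisher E (piL e) *m (rsubmx v)^T) 0 0.
Proof.
rewrite /metric /= -{1}[u]hsubmxK -{1}[v]hsubmxK mul_row_block !mulmx0.
by rewrite addr0 add0r tr_row_mx mul_row_col mxE.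
Qed.

Lemma quotient_metric_definite (Y : 'rV[R]_n -> 'M[R]_n)
  (e : quotient_kmanifold E Y) u : metric e u u = 0 -> u = 0.
Proof.
rewrite quotient_metricE => /eqP; rewrite paddr_eq0 ?fisher_ge0//.
move=> /andP[/eqP/fisher_definite ul /eqP/fisher_definite ur].
by rewrite -[u]hsubmxK ul ur row_mx0.
Qed.

(** The coordinate of [e] is picked by [xget] among the points of its class near [repr e]; [repr e]
    is one of them, so the choice does project to [e]. *)
Lemma quotient_coordP (Y : 'rV[R]_n -> 'M[R]_n) (e : quotient_kmanifold E Y) :
  [/\ cdom (chart_at e) e, ccod (chart_at e) (coord_at e)
    & qL Y (coord_at e) = e].
Proof.
have qe : qL Y (repr (e : tquot Y)) = e by exact: reprK.
have ne : tquot_nbhs Y (repr (e : tquot Y)) (repr (e : tquot Y)).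
  exists 0; split; first by move=> i; rewrite mxE normr0 invr_gt0.
  by rewrite mul0mx addr0.
have ce : cdom (chart_at e) e by exists (repr (e : tquot Y)).
split=> //; first by exists e.
rewrite /coord_at /=.
by have [] := @xgetI _ (repr (e : tquot Y))
  [set u | tquot_nbhs Y (repr (e : tquot Y)) u /\ qL Y u = e] _ (conj ne qe).
Qed.

Variables (N : kmanifold R n) (Phi : torus R n -> N -> N).
Hypothesis hN : is_kahler N.
Variables (Y : 'rV[R]_n -> 'M[R]_n) (G : quotient_kmanifold E Y -> N).
Hypothesis hG : torification_data Phi G.
Variables (phi phi' : N -> N).
Hypotheses (sphi : smooth_map_on setT phi) (sphi' : smooth_map_on setT phi').
Hypotheses (phiK : cancel phi phi') (phi'K : cancel phi' phi).
Hypothesis phi_isometry : forall p u v,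
  metric (phi p) (tangent_map phi p u) (tangent_map phi p v) = metric p u v.
Variables (X : Omega -> R) (f : N -> R).
Hypothesis smf : smooth_fun f.
Hypothesis fG : forall e p,
  phi p = G e -> f p = prob_mean (ef_prob E (piL e)) X.

(** Near [p], [phi'] after [G] is an isometric parametrisation of N in the coordinates (theta,
    theta-dot), and [f] becomes the mean of X as a function of theta alone. *)
Lemma grad_norm_free_point (a : 'I_n -> R) (b : R) (p : N)
    (e : quotient_kmanifold E Y) :
  (forall x, X x = \sum_k a k * ef_F E k x + b) -> phi p = G e ->
  prob_var (ef_prob E (piL e)) X = metric p (grad f p) (grad f p).
Proof.
move=> XE pe; have [_ [sG _ _ isoG] _] := hG.
have [dB isoB] := inverse_isometry hN sphi sphi' phiK phi'K phi_isometry p.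
set B := _ \o cinv (chart_at (phi p)) in dB isoB.
have [ce cce qe] := quotient_coordP e; set u1 := coord_at e in cce qe.
have [ac cp cC] := chart_atP hN p.
have [ac' cp' cC'] := chart_atP hN (phi p).
pose A := cmap (chart_at (phi p)) \o G \o cinv (chart_at e).
have dA : differentiable A u1.
  apply: (sG.2 _ _ _ ac' [::]); first by exists (repr (e : tquot Y)).
  by split=> //; rewrite /= qe -pe.
have Au1 : A u1 = coord_at (phi p) by rewrite /A /= qe -pe.
have isoA u v : metric (phi p) ('d A u1 u) ('d A u1 v) = metric e u v.
  by have := isoG e u v; rewrite /tangent_map -pe.
have contG : nbhs u1 [set y | (cdom (chart_at (phi p)) `&`
    phi' @^-1` cdom (chart_at p)) (G (qL Y y))].
  have cGq : {for u1, continuous (G \o (qL Y : Cn R n -> tquot Y))}.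
    apply: continuous_comp; first exact: pi_continuous.
    exact: (sG.1 (qL Y u1) I).
  apply: cGq; rewrite /= qe -pe; apply: filterI; first exact: nbhs_cdom.
  by apply: (sphi'.1 (phi p) I); rewrite /= phiK; exact: nbhs_cdom.
pose m : Cn R n -> R^o := (fun t => prob_mean (ef_prob E t) X : R^o) \o lsubmx.
pose h : Cn R n -> R^o := f \o cinv (chart_at p).
have BA : B (coord_at (phi p)) = coord_at p.
  by rewrite /B /coord_at /= chart_invK// phiK.
have dh : differentiable h (coord_at p).
  by apply: (smf ac [::]); exact: chart_ccod.
(* On the neighbourhood [contG] the intermediate charts cancel, leaving [f] at
   [phi' (G (qL Y y))]. *)
have hS : \forall y \near u1, h (B (A y)) = m y.
  move: contG; apply: filterS => y /= [cy cy'].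
  rewrite /h /B /A /m /= (chart_invK cC' cy) (chart_invK cC cy').
  by rewrite (fG (e := qL Y y)) ?piLE// phi'K.
have th : lsubmx u1 = piL (e : tquot Y) by rewrite -(piLE Y) qe.
have dfE u : dfun f p ('d B (coord_at (phi p)) ('d A u1 u)) = 'd m u1 u.
  exact: (diff_comp3_near Au1 BA dA dB dh hS).
have dmE u : 'd m u1 u = ((\row_k a k) *m fisher E (piL e) *m (lsubmx u)^T) 0 0.
  rewrite /m diff_comp /=; last exact: (ef_mean_derive _ _ _).1; last first.
    exact: differentiable_lsubmx.
  rewrite (ef_span_diff_mean _ _ XE) th.
  by rewrite (diff_lin (f := lsubmx))//; exact: continuous_lsubmx.
rewrite (ef_span_var _ XE).
(* The gradient upstairs is (a, 0): the second block vanishes because [m] does not depend on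
   theta-dot. *)
rewrite (@grad_norm_pullback _ _ N hN f p
  ('d B (coord_at (phi p)) \o 'd A u1) (gram e) (row_mx (\row_k a k) 0)).
- rewrite -[RHS]/(metric e _ _) quotient_metricE !row_mxKl !row_mxKr.
  by rewrite mul0mx trmx0 mulmx0 [X in _ = _ + X]mxE addr0.
- move=> u v; rewrite -[RHS]/(metric e u v) -isoA; exact: isoB.
- exact: quotient_metric_definite.
- move=> u; rewrite -[RHS]/(metric e _ u) quotient_metricE row_mxKl row_mxKr.
  rewrite mul0mx mul0mx [X in _ = _ + X]mxE addr0.
  rewrite -dmE; exact: dfE.
Qed.

End Torification.

(** * Extension of the identity to all of N by continuity *)

Lemma continuous_prob_var (R : realType) (Omega : finType) (T : topologicalType)
    (q : T -> Omega -> R) (X : Omega -> R) :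
  (forall x, continuous (fun p => q p x)) ->
  continuous (fun p => prob_var (q p) X).
Proof.
move=> cq p; rewrite /continuous_at /prob_var /prob_mean.
have cmean : (\sum_x X x * q p x) @[p --> p] --> \sum_x X x * q p x.
  by apply: cvg_big_sum => x; apply: cvgM; [exact: cvg_cst|exact: cq].
apply: cvg_big_sum => x; apply: cvgM; last exact: cq.
under eq_fun do rewrite expr2; rewrite expr2.
by apply: cvgM; (apply: cvgB; [exact: cvg_cst|exact: cmean]).
Qed.

Lemma continuous_eq_dense (T S : topologicalType) (A : set T) (f g : T -> S) :
  hausdorff_space S -> continuous f -> continuous g -> dense A ->
  (forall x, A x -> f x = g x) -> forall x, f x = g x.
Proof.
move=> hS cf cg dA fgA x; apply: (closed_equalizer hS cf cg) => B xB.
have [|y [By Ay]] := dA (interior B) _ (open_interior B); first by exists x.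
by exists y; split; [exact: fgA|exact: interior_subset].
Qed.

Theorem theorem7p1 (R : realType) (n : nat) (Omega : finType)
  (E : exp_family R n Omega) (N : kmanifold R n) (Phi : torus R n -> N -> N)
  (hN : kahler_toric Phi) (hE : regular_torification E Phi)
  (K : N -> Omega -> R) (hK : natural_extension E Phi K)
  (phi : N -> N) (hphi : Aut0 N phi)
  (X : Omega -> R) (hX : ef_span E X)
  (f : N -> R) (hf : forall p : N, f p = prob_mean (K (phi p)) X)
  (hfK : kahler_function f) (p : N) :
  prob_var (K (phi p)) X = metric p (grad f p) (grad f p).
Proof.
have kN := toric_kahler hN.
have [sphi [phi' [sphi' phiK phi'K]] _ isophi] := connected_component_sub hphi.
have {}phiK : cancel phi phi' by move=> q; have [] := phiK q.
have {}phi'K : cancel phi' phi by move=> q; exact: phi'K.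
have cphi : continuous phi by move=> q; exact: sphi.1.
have cphi' : continuous phi' by move=> q; exact: sphi'.1.
have [kappa [Y [G [hG kG]]] [cK _ Kkappa]] := hK.
have [a [b XE]] := hX.
have [_ [_ [G' [_ GU G'K]] _ _] _] := hG.
have KG e : K (G e) = ef_prob E (piL e).
  by rewrite Kkappa ?kG//; have [] := GU e.
(* The dense set consists of the points that [phi] sends to free points, where [phi q] is [G] of
   some [e] and [KG] computes [K]. *)
apply: (@continuous_eq_dense _ _ (phi @^-1` free_points Phi)
  (fun q => prob_var (K (phi q)) X) (fun q => metric q (grad f q) (grad f q))).
- exact: norm_hausdorff.
- apply: continuous_prob_var => x q.
  apply: (@continuous_comp _ _ _ phi (fun r => K r x)); first exact: cphi.
  apply: (@continuous_comp _ _ _ (K : N -> {ptws Omega -> R}) (proj x)).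
    exact: cK.
  exact: proj_continuous.
- exact: (continuous_grad_norm kN hfK.1).
(* Since [phi] is a homeomorphism, a free point in the image of [O] gives a point of [O] in the
   preimage. *)
- move=> O [q Oq] oO.
  have [||r [Or fr]] := dense_free_points hN (O := phi' @^-1` O).
  + by exists (phi q); rewrite /= phiK.
  + by move/continuousP: cphi'; exact.
  by exists (phi' r); split; rewrite //= phi'K.
- move=> q /= fq; have qG : phi q = G (G' (phi q)) by rewrite G'K.
  rewrite qG KG.
  apply: (grad_norm_free_point kN hG sphi sphi' phiK phi'K isophi hfK.1 _ XE
    qG).
  by move=> e r re; rewrite hf re KG.
Qed.
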